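(* Let $X$ and $Y$ be white Lévy noises with $X_0=\int_0^1X$, $Y_0=\int_0^1Y$, each satisfying the hypotheses of the existence theorem for $\kappa,\zeta$ (stated below in context) corresponding to its type, and let $\kappa_X,\zeta_X,m_X$ and $\kappa_Y,\zeta_Y,m_Y$ be the associated functions given by that theorem. (1) If $X_0$ is discrete and $Y_0$ is discrete-continuous, then $\lim_{n\to\infty}\sup_{m\ge m(n)}\frac{\mathcal H_{m,n}(X)}{\mathcal H_{m,n}(Y)}=0$ for any $m(n)\ge\max\{m_X(n),m_Y(n)\}$ with $\lim_{n\to\infty}\frac{\log m(n)}{\log n}=\infty$. (2) If $X_0$ is discrete-continuous and $Y_0$ is continuous, then $\lim_{n\to\infty}\sup_{m\ge m(n)}\frac{\mathcal H_{m,n}(X)}{\mathcal H_{m,n}(Y)}=0$ for any $m(n)\ge\max\{m_X(n),m_Y(n)\}$ with $\lim_{n\to\infty}\frac{\log m(n)}{\zeta_Y(n)}=\infty$. (3) If $X_0$ is continuous and $Y$ is a Gaussian white noise (triplet with $\sigma>0$ and $V\equiv0$), then $\limsup_{n\to\infty}\sup_{m\ge m(n)}\frac{\mathcal H_{m,n}(X)}{\mathcal H_{m,n}(Y)}\le1$ for any $m(n)\ge\max\{m_X(n),m_Y(n)\}$ with $\lim_{n\to\infty}m(n)/\sqrt n=\infty$.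
   Context: A white Lévy noise $X$ with triplet $(\mu,\sigma,V)$ has characteristic functional $\mathbb E[e^{j\langle X,\varphi\rangle}]=\exp(\int f(\varphi(t))dt)$, $f(\omega)=-\frac{\sigma^2}{2}\omega^2+j\mu\omega+\int_{\mathbb R\setminus\{0\}}(e^{j\omega a}-1-j\omega a\mathbf 1_{(-1,1)}(a))dV(a)$ with $V$ a Lévy measure distribution function (non-decreasing, continuous at 0, $V(-\infty)=0$, $\int\min\{1,a^2\}dV<\infty$, $\int_{|a|>1}|a|^\theta dV<\infty$ for some $\theta>0$); $V=V_d+V_{ac}+V_{cs}$ is its decomposition into discrete, absolutely continuous and continuous-singular parts. $X_1^{(n)}=\int_0^{1/n}X(t)dt$, $[x]_m=\frac1m\lfloor\frac12+mx\rfloor$, $\mathcal H_{m,n}(X)=nH([X_1^{(n)}]_m)$. The existence theorem referred to: (a) if $X_0$ is discrete (and $H(X_0),H(A)<\infty$, $A\sim V/\int dV$), there are $m(n),\zeta(n)$ with $\sup_{m\ge m(n)}|\mathcal H_{m,n}(X)-\zeta(n)|\to0$ and $c_1\log n\le\zeta(n)\le c_2\log n$ ($0<c_1\le c_2$); here $\kappa\equiv1$; (b) if $X_0$ is discrete-continuous (under finiteness of the relevant entropies), with $\kappa(n)=n(1-\exp[-\frac\lambda n(1-\alpha)])$, $\lambda=\int dV$, $\alpha=\int dV_d/\lambda$, there are $m(n),\zeta(n)$ with $\sup_{m\ge m(n)}|\mathcal H_{m,n}(X)/\kappa(n)-\log m-\zeta(n)|\to0$ and $c_1\log n\le\zeta(n)\le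 c_2\log n$; (c) if $X_0$ is continuous ($\sigma>0$ or $\int dV_{ac}=\infty$, $H([X_0]_1)<\infty$, $h(X_1^{(n)})$ well-defined), with $\kappa(n)=n$, $\zeta(n)=h(X_1^{(n)})$ (non-increasing), there is $m(n)$ with $\sup_{m\ge m(n)}|\mathcal H_{m,n}(X)/n-\log m-\zeta(n)|\to0$. Discrete / continuous / discrete-continuous random variables are as usual (countable values; absolutely continuous law; mixture with probability strictly in $(0,1)$ on a countable set and absolutely continuous otherwise). *)

(* Defs.v *)
From HB Require Import structures.
From mathcomp Require Import all_boot all_order all_algebra.
From mathcomp Require Import all_classical all_reals all_analysis.
Set Implicit Arguments. Unset Strict Implicit. Unset Printing Implicit Defensive.
Import Order.TTheory GRing.Theory Num.Theory.
Import numFieldNormedType.Exports.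
Local Open Scope classical_set_scope.
Local Open Scope ring_scope.

Section LevyDefs.
Variable R : realType.

(** nu is a Lévy measure (the measure dV of a Lévy measure distribution
    function V, continuous at 0), with the moment condition for some theta>0. *)
Definition levy_measure (nu : {measure set R -> \bar R}) : Prop :=
  nu [set 0] = 0%E /\
  (\int[nu]_(a in [set: R]) (Num.min 1 (a ^+ 2))%:E < +oo)%E /\
  exists theta : R, 0 < theta /\
    (\int[nu]_(a in [set a : R | (1 < `|a|)%R]) (powR `|a|%R theta)%:E < +oo)%E.

Definition levy_decomposition (nu nud nuac nucs : {measure set R -> \bar R}) : Prop :=
  (forall A, measurable A -> nu A = (nud A + nuac A + nucs A)%E) /\
  (exists S : set R, countable S /\ nud (~` S) = 0%E) /\
  (forall A, measurable A -> (@lebesgue_measure R) A = 0%E -> nuac A = 0%E) /\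
  (forall x : R, nucs [set x] = 0%E) /\
  (exists N : set R, measurable N /\ (@lebesgue_measure R) N = 0%E /\
                     nucs (~` N) = 0%E).

Definition levy_exp_re (sigma : R) (nu : {measure set R -> \bar R}) (w : R) : R :=
  - (sigma ^+ 2 * w ^+ 2) / 2 + Rintegral nu [set: R] (fun a => cos (w * a) - 1).

Definition levy_exp_im (mu : R) (nu : {measure set R -> \bar R}) (w : R) : R :=
  mu * w + Rintegral nu [set: R]
             (fun a => sin (w * a) - (if `|a| < 1 then w * a else 0)).

(** P is the law of X_1^{(n)} = <X, 1_[0,1/n]>, whose characteristic
    function is exp(f(w)/n) (real and imaginary parts written out). *)
Definition law_of_increment (mu sigma : R) (nu : {measure set R -> \bar R})
    (n : nat) (P : probability R R) : Prop :=
  forall w : R,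
    Rintegral P [set: R] (fun x => cos (w * x)) =
      expR (levy_exp_re sigma nu w / n%:R) * cos (levy_exp_im mu nu w / n%:R) /\
    Rintegral P [set: R] (fun x => sin (w * x)) =
      expR (levy_exp_re sigma nu w / n%:R) * sin (levy_exp_im mu nu w / n%:R).

(** White Lévy noise with triplet (mu, sigma, nu) (decomposition nud+nuac+nucs),
    given through the laws P n of X_1^{(n)}, n >= 1 (P 1 is the law of X_0). *)
Definition white_levy_noise (mu sigma : R)
    (nu nud nuac nucs : {measure set R -> \bar R}) (P : nat -> probability R R) : Prop :=
  0 <= sigma /\ levy_measure nu /\ levy_decomposition nu nud nuac nucs /\
  forall n : nat, (0 < n)%N -> law_of_increment mu sigma nu n (P n).

Definition abs_cont_law (P : probability R R) : Prop :=
  forall A, measurable A -> (@lebesgue_measure R) A = 0%E -> P A = 0%E.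

Definition discrete_law (P : probability R R) : Prop :=
  exists S : set R, countable S /\ P S = 1%E.

Definition continuous_law (P : probability R R) : Prop := abs_cont_law P.

Definition discrete_continuous_law (P : probability R R) : Prop :=
  exists S : set R, countable S /\ (0 < P S)%E /\ (P S < 1)%E /\
    forall A, measurable A -> (@lebesgue_measure R) A = 0%E -> P (A `\` S) = 0%E.

Definition negplogp (p : R) : R := - (p * ln p).

Definition entropy_disc (P : probability R R) : \bar R :=
  (\esum_(x in [set: R]) (negplogp (fine (P [set x])))%:E)%E.

Definition quant (m : nat) (x : R) : R :=
  (m%:R)^-1 * (Num.floor (2^-1 + m%:R * x))%:~R.

Definition entropy_quant (P : probability R R) (m : nat) : \bar R :=
  (\esum_(y in [set: R]) (negplogp (fine (P (quant m @^-1` [set y]))))%:E)%E.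

Definition Hmn (P : nat -> probability R R) (m n : nat) : \bar R :=
  ((n%:R)%:E * entropy_quant (P n) m)%E.

Definition is_diff_entropy (P : probability R R) (z : R) : Prop :=
  exists g : R -> R, measurable_fun [set: R] g /\ (forall x, 0 <= g x) /\
    (forall A, measurable A ->
       P A = (\int[@lebesgue_measure R]_(x in A) (g x)%:E)%E) /\
    (@lebesgue_measure R).-integrable [set: R] (fun x => (g x * ln (g x))%:E) /\
    z = - Rintegral (@lebesgue_measure R) [set: R] (fun x => g x * ln (g x)).

Definition hyp_discrete (nu : {measure set R -> \bar R}) (P : nat -> probability R R) : Prop :=
  discrete_law (P 1%N) /\ (entropy_disc (P 1%N) < +oo)%E /\
  (0 < nu [set: R])%E /\ (nu [set: R] < +oo)%E /\
  (\esum_(x in [set: R])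
      (negplogp (fine (nu [set x]) / fine (nu [set: R])))%:E < +oo)%E.

Definition hyp_discrete_continuous (P : nat -> probability R R) : Prop :=
  discrete_continuous_law (P 1%N).

Definition hyp_continuous (sigma : R) (nuac : {measure set R -> \bar R})
    (P : nat -> probability R R) : Prop :=
  continuous_law (P 1%N) /\ (0 < sigma \/ nuac [set: R] = +oo%E) /\
  (entropy_quant (P 1%N) 1 < +oo)%E /\
  (forall n : nat, (0 < n)%N -> exists z : R, is_diff_entropy (P n) z).

Definition supm (mf : nat -> nat) (n : nat) (F : nat -> \bar R) : \bar R :=
  ereal_sup [set F m | m in [set m : nat | (mf n <= m)%N /\ (0 < m)%N]].

Definition log_bounds (zeta : nat -> R) : Prop :=
  exists c1 c2 : R, 0 < c1 /\ c1 <= c2 /\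
    \forall n \near \oo, c1 * ln n%:R <= zeta n /\ zeta n <= c2 * ln n%:R.

(** (a): kappa = 1. *)
Definition concl_discrete (P : nat -> probability R R) (mf : nat -> nat)
    (zeta : nat -> R) : Prop :=
  (fun n => supm mf n (fun m => `| Hmn P m n - (zeta n)%:E |)%E) @ \oo --> 0%E /\
  log_bounds zeta.

Definition kappa_dc (nu nud : {measure set R -> \bar R}) (n : nat) : R :=
  let lambda := fine (nu [set: R]) in
  let alpha := fine (nud [set: R]) / lambda in
  n%:R * (1 - expR (- (lambda / n%:R) * (1 - alpha))).

Definition concl_discrete_continuous (nu nud : {measure set R -> \bar R})
    (P : nat -> probability R R) (mf : nat -> nat) (zeta : nat -> R) : Prop :=
  (fun n => supm mf n (fun m =>
      `| Hmn P m n * ((kappa_dc nu nud n)^-1)%:E - (ln m%:R + zeta n)%:E |)%E)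
     @ \oo --> 0%E /\
  log_bounds zeta.

(** (c): kappa(n) = n, zeta(n) = h(X_1^{(n)}) non-increasing. *)
Definition concl_continuous (P : nat -> probability R R) (mf : nat -> nat)
    (zeta : nat -> R) : Prop :=
  (forall n : nat, (0 < n)%N -> is_diff_entropy (P n) (zeta n)) /\
  (forall n k : nat, (0 < n)%N -> (n <= k)%N -> zeta k <= zeta n) /\
  (fun n => supm mf n (fun m =>
      `| Hmn P m n * ((n%:R)^-1)%:E - (ln m%:R + zeta n)%:E |)%E)
     @ \oo --> 0%E.

Definition sup_ratio (PX PY : nat -> probability R R) (mf : nat -> nat) (n : nat) : \bar R :=
  supm mf n (fun m => (fine (Hmn PX m n) / fine (Hmn PY m n))%:E).

End LevyDefs.

(* Main.v *)
Require Import Defs.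
From HB Require Import structures.
From mathcomp Require Import all_boot all_order all_algebra.
From mathcomp Require Import all_classical all_reals all_analysis.
From mathcomp Require Import measurable_realfun ring lra zify.
Import Order.TTheory GRing.Theory Num.Theory.
Import numFieldNormedType.Exports.
Local Open Scope classical_set_scope.
Local Open Scope ring_scope.

(** Parts (1) and (2) compare asymptotic expansions: the conclusion of (b)
    forces [kappa] to stay between two positive constants, so
    [H(X)/H(Y)] is of order [ln n / ln m] in (1) and of order
    [(ln m + ln n) / (n ln m)] in (2).

    Part (3) rests on the comparison [h(X_1^(n)) <= C - (ln n)/2] for every
    Levy noise and [H([Y_1^(n)]_m) >= ln m - (ln n)/2 - C] for the Gaussian
    one. Both are read off the characteristic function [phi_n = exp(f/n)]
    through the averages
      [E K(t (X - c)) = int_0^1 (1 - u) (1 - Re (exp(-iutc) phi_n(ut))) du],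
    where [K(y) = int_0^1 (1 - u) (1 - cos(uy)) du] is bounded away from 0
    for large [y] and from its supremum 1/2 for small [y].
    Upper bound: Gibbs' inequality against the Cauchy density of scale
    [1/sqrt n] reduces the claim to a bound on [E ln(1 + n X^2)], which is
    dominated by a constant plus a multiple of [sum_k E K(2^-k sqrt n X)];
    the bound [1 - Re phi_n(r sqrt n) <= C r^theta] makes the series geometric.
    Lower bound: [E K] controls the mass of short intervals, so all cells of
    the quantizer have probability [O(sqrt n / m)]. *)

Set Implicit Arguments.
Unset Strict Implicit.

(** * Entropy ratios from asymptotic expansions *)

Section Ratio.
Context {R : realType}.
Implicit Types (P PX PY : nat -> probability R R) (mX mY mf : nat -> nat) (z : nat -> R).

Lemma negplogp_ge0 (p : R) : 0 <= p <= 1 -> 0 <= negplogp p.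
Proof.
by move=> /andP[p0 p1]; rewrite /negplogp -mulrN mulr_ge0// oppr_ge0 ln_le0.
Qed.

Lemma probability_fine_itv (P : probability R R) (A : set R) :
  measurable A -> 0 <= fine (P A) <= 1.
Proof.
move=> mA; rewrite fine_ge0//=.
have := probability_le1 P mA; have := measure_ge0 P A.
by case: (P A) => [r| |] //; rewrite !lee_fin.
Qed.

Lemma measurable_quant m : measurable_fun [set: R] (quant m).
Proof.
apply: nondecreasing_measurable => // x y xy.
by rewrite /quant ler_wpM2l// ler_int le_floor// lerD2l ler_wpM2l.
Qed.

Lemma measurable_quant_cell m (y : R) : measurable (quant m @^-1` [set y]).
Proof.
by rewrite -[X in measurable X]setTI; exact: measurable_quant.
Qed.

Lemma entropy_quant_ge0 (P : probability R R) m : (0 <= entropy_quant P m)%E.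
Proof.
apply: esum_ge0 => y _; rewrite lee_fin negplogp_ge0//.
by apply: probability_fine_itv; exact: measurable_quant_cell.
Qed.

Lemma Hmn_ge0 P m n : (0 <= Hmn P m n)%E.
Proof. by rewrite mule_ge0 ?entropy_quant_ge0// lee_fin. Qed.

(** Convergence to 0 in the extended reals makes the supremum eventually finite, so it bounds every
    term; passing from [mX] to the larger [mf] only shrinks the index set. *)
Lemma supm_near (F : nat -> nat -> \bar R) mX mf :
  (fun n => supm mX n (F n)) @ \oo --> 0%E ->
  (forall n, (mX n <= mf n)%N) ->
  forall e : R, 0 < e -> \forall n \near \oo,
    forall m, (mf n <= m)%N -> (0 < m)%N -> (F n m < e%:E)%E.
Proof.
move=> /fine_cvgP[Ffin Fcvg] mXf e e0.
have /cvgr0Pnorm_lt/(_ _ e0) Fe := Fcvg.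
near=> n => m nm m0.
have h1 : supm mX n (F n) \is a fin_num by near: n.
have h2 : `|fine (supm mX n (F n))| < e by near: n.
apply: (@le_lt_trans _ _ (supm mX n (F n))).
  by apply: ereal_sup_ubound; exists m => //; split => //; exact: leq_trans nm.
by rewrite -(fineK h1) lte_fin (le_lt_trans (ler_norm _)).
Unshelve. all: by end_near. Qed.

Lemma sup_ratio_le PX PY mf n (e : R) :
  (forall m, (mf n <= m)%N -> (0 < m)%N ->
    fine (Hmn PX m n) / fine (Hmn PY m n) <= e) ->
  (sup_ratio PX PY mf n <= e%:E)%E.
Proof.
by move=> h; apply: ub_ereal_sup => _ [m [nm m0] <-]; rewrite lee_fin h.
Qed.

(** The index set contains [maxn (mf n) 1], so the supremum is never the [-oo] of an empty set, and
    any real upper bound makes it finite. *)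
Lemma sup_ratio_ge0 PX PY mf n : (0 <= sup_ratio PX PY mf n)%E.
Proof.
apply: (@le_trans _ _ (fine (Hmn PX (maxn (mf n) 1) n) /
                       fine (Hmn PY (maxn (mf n) 1) n))%:E).
  by rewrite lee_fin divr_ge0// fine_ge0// Hmn_ge0.
apply: ereal_sup_ubound; exists (maxn (mf n) 1) => //.
by split; rewrite leq_max ?leqnn ?orbT.
Qed.

Lemma sup_ratio_cvg0 PX PY mf :
  (forall e : R, 0 < e -> \forall n \near \oo,
    forall m, (mf n <= m)%N -> (0 < m)%N ->
      fine (Hmn PX m n) / fine (Hmn PY m n) <= e) ->
  sup_ratio PX PY mf @ \oo --> 0%E.
Proof.
move=> h; have fin n (e : R) : (sup_ratio PX PY mf n <= e%:E)%E ->
    sup_ratio PX PY mf n \is a fin_num.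
  by move=> le; rewrite ge0_fin_numE ?sup_ratio_ge0// (le_lt_trans le) ?ltry.
apply/fine_cvgP; split.
  near=> n; apply: (fin _ 1); apply: sup_ratio_le; near: n.
  exact: h.
apply/cvgr0Pnorm_le => e e0; near=> n.
have le : (sup_ratio PX PY mf n <= e%:E)%E.
  by apply: sup_ratio_le; near: n; exact: h.
rewrite /= ger0_norm ?fine_ge0 ?sup_ratio_ge0//.
by rewrite -lee_fin fineK//; exact: fin le.
Unshelve. all: by end_near. Qed.

(** * Eventual estimates on the finite part of the entropy *)

Lemma concl_discrete_near P mX mf z (e : R) :
  concl_discrete P mX z -> (forall n, (mX n <= mf n)%N) -> 0 < e ->
  \forall n \near \oo, forall m, (mf n <= m)%N -> (0 < m)%N ->
    `|fine (Hmn P m n) - z n| < e.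
Proof.
move=> [cv _] mXf e0; have := supm_near cv mXf e0.
apply: filterS => n h m nm m0; have := h m nm m0.
(* An infinite entropy is excluded, since its distance to [z n] would be [+oo]. *)
by have := Hmn_ge0 P m n; case: (Hmn P m n) => [r| |].
Qed.

(* A non-positive [kappa] (in particular the junk value 0 arising from an
   infinite Levy measure) is incompatible with the conclusion of (b), since
   [ln m] is unbounded while [H] is non-negative. *)
Lemma kappa_dc_bounds nu nud P mX z :
  concl_discrete_continuous nu nud P mX z ->
  exists2 c : R, 0 < c &
    forall n, (0 < n)%N -> c / (1 + c) <= kappa_dc nu nud n <= c.
Proof.
move=> [cv [c1 [c2 [c10 [c12 zb]]]]].
pose c : R := fine (nu setT) * (1 - fine (nud setT) / fine (nu setT)).
have kE n : kappa_dc nu nud n = n%:R * (1 - expR (- (c / n%:R))).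
  by rewrite /kappa_dc /c; congr (_ * (1 - expR _)); ring.
have c0 : 0 < c.
  rewrite ltNge; apply/negP => c0.
  have l2 : 0 < ln 2 :> R by rewrite ln_gt0// ltr1n.
  have key : \forall n \near \oo, False.
    have nr := supm_near cv (fun=> leqnn _) l2.
    near=> n.
    have n0 : (0 < n)%N by near: n; exact: nbhs_infty_gt.
    (* Taking [m >= 2] makes [ln m + z n] at least [ln 2], the tolerance chosen in [nr], whereas a
       non-positive kappa makes the quotient of the entropy non-positive. *)
    pose m := maxn (mX n) 2.
    have : (`|Hmn P m n * ((kappa_dc nu nud n)^-1)%:E - (ln m%:R + z n)%:E|
             < (ln 2)%:E)%E.
      move: (m) (leq_maxl (mX n) 2 : (mX n <= m)%N)
        (ltnW (leq_maxr (mX n) 2) : (0 < m)%N).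
      by near: n; exact: nr.
    have zn : 0 <= z n.
      have : c1 * ln n%:R <= z n /\ z n <= c2 * ln n%:R by near: n.
      by move=> [+ _]; apply: le_trans; rewrite mulr_ge0 ?ln_ge0 ?ler1n// ltW.
    have lm : ln 2 <= ln m%:R :> R.
      by rewrite ler_ln ?posrE ?ltr0n ?ler_nat ?leq_max ?leqnn ?orbT.
    have k0 : (kappa_dc nu nud n)^-1 <= 0.
      rewrite invr_le0 kE pmulr_rle0 ?ltr0n// subr_le0.
      apply: le_trans (expR_ge1Dx _); rewrite lerDl oppr_ge0.
      by rewrite pmulr_lle0// invr_gt0 ltr0n.
    have := Hmn_ge0 P m n; case: (Hmn P m n) => [r| |] // r0.
      rewrite lte_fin ltNge => /negP; apply.
      rewrite lee_fin in r0.
      have : r * (kappa_dc nu nud n)^-1 <= 0 by rewrite mulr_ge0_le0.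
      by move=> ?; rewrite ler0_norm; lra.
    (* For infinite entropy the product is 0 when the inverse of kappa is 0, and [-oo] otherwise;
       both lie at distance at least [ln 2]. *)
    move: k0; rewrite le_eqVlt => /orP[/eqP ->|k0].
      rewrite mule0 sub0e lte_fin normrN ltNge => /negP; apply.
      by rewrite ger0_norm; lra.
    by rewrite mulyr ltr0_sg// mulN1e.
  by case: key => N _ /(_ N (leqnn _)).
exists c => // n n0; have nR : 0 < n%:R :> R by rewrite ltr0n.
rewrite kE; apply/andP; split; last first.
  have := expR_ge1Dx (- (c / n%:R)) => h.
  have -> : c = n%:R * (c / n%:R) by field; rewrite gt_eqF.
  rewrite [X in 1 - expR (- (X / _))](_ : _ = c); first by rewrite ler_pM2l//; lra.
  by field; rewrite gt_eqF.
(* Lower bound: [1 - exp(-x) >= x / (1 + x)] gives [c / (1 + x)] after multiplication by [n], and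
   [x <= c]. *)
pose x := c / n%:R.
have x0 : 0 < x by rewrite divr_gt0.
have xc : x <= c by rewrite ler_pdivrMr// ler_peMr ?ler1n// ltW.
have ex : expR (- x) <= (1 + x)^-1.
  by rewrite expRN lef_pV2 ?posrE ?expR_gt0 ?expR_ge1Dx//; lra.
apply: (@le_trans _ _ (n%:R * (1 - (1 + x)^-1))); last first.
  by rewrite ler_pM2l// lerB.
have -> : n%:R * (1 - (1 + x)^-1) = c / (1 + x).
  rewrite /x; field; rewrite gt_eqF//=; rewrite gt_eqF//; lra.
by rewrite ler_pM2l// lef_pV2 ?posrE; lra.
Unshelve. all: by end_near. Qed.

Lemma concl_discrete_continuous_near nu nud P mX mf z (e : R) :
  concl_discrete_continuous nu nud P mX z ->
  (forall n, (mX n <= mf n)%N) -> 0 < e ->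
  \forall n \near \oo, forall m, (mf n <= m)%N -> (0 < m)%N ->
    `|fine (Hmn P m n) / kappa_dc nu nud n - (ln m%:R + z n)| < e.
Proof.
move=> dc mXf e0; have [c c0 kb] := kappa_dc_bounds dc.
case: dc => cv _; have nr := supm_near cv mXf e0.
near=> n => m nm m0.
have n0 : (0 < n)%N by near: n; exact: nbhs_infty_gt.
have k0 : 0 < kappa_dc nu nud n.
  have /andP[+ _] := kb n n0; apply: lt_le_trans.
  by rewrite divr_gt0// addr_gt0.
have : (`|Hmn P m n * ((kappa_dc nu nud n)^-1)%:E - (ln m%:R + z n)%:E|
           < e%:E)%E.
  by move: m nm m0; near: n; exact: nr.
have := Hmn_ge0 P m n; case: (Hmn P m n) => [r| |] //.
by rewrite mulyr gtr0_sg ?invr_gt0// mul1e.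
Unshelve. all: by end_near. Qed.

(** Finiteness is recorded as well because part (3) transfers an extended-real lower bound on the
    Gaussian entropy to its finite part. *)
Lemma concl_continuous_near P mX mf z (e : R) :
  concl_continuous P mX z -> (forall n, (mX n <= mf n)%N) -> 0 < e ->
  \forall n \near \oo, forall m, (mf n <= m)%N -> (0 < m)%N ->
    Hmn P m n \is a fin_num /\
    `|fine (Hmn P m n) / n%:R - (ln m%:R + z n)| < e.
Proof.
move=> [_ [_ cv]] mXf e0; have nr := supm_near cv mXf e0.
near=> n => m nm m0.
have n0 : 0 < n%:R :> R by rewrite ltr0n; near: n; exact: nbhs_infty_gt.
have : (`|Hmn P m n * (n%:R^-1)%:E - (ln m%:R + z n)%:E| < e%:E)%E.
  by move: m nm m0; near: n; exact: nr.
have := Hmn_ge0 P m n; case: (Hmn P m n) => [r| |] //.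
by rewrite mulyr gtr0_sg ?invr_gt0// mul1e.
Unshelve. all: by end_near. Qed.

(** * Growth of the logarithm and the ratios of parts (1) and (2) *)

Lemma ln_nat_sqrt n : ln n%:R = 2 * ln (Num.sqrt n%:R) :> R.
Proof.
(* At [n = 0] both sides are 0, the default value of [ln]. *)
case: n => [|n]; first by rewrite sqrtr0 ln0// mulr0.
by rewrite -[in LHS](sqr_sqrtr (ler0n R n.+1)) lnXn ?mulr_natl// sqrtr_gt0.
Qed.

Lemma ln_nat_near (A : R) : \forall n \near \oo, A <= ln n%:R.
Proof.
near=> n.
rewrite -[A]expRK ler_ln ?posrE ?expR_gt0//; last first.
  by rewrite ltr0n; near: n; exact: nbhs_infty_gt.
by near: n; exact: nbhs_infty_ger.
Unshelve. all: by end_near. Qed.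

Lemma ratio_discrete_dc nuY nudY PX PY mX mY mf zX zY :
  concl_discrete PX mX zX ->
  concl_discrete_continuous nuY nudY PY mY zY ->
  (forall n, (maxn (mX n) (mY n) <= mf n)%N) ->
  (fun n : nat => ln (mf n)%:R / ln n%:R : R) @ \oo --> +oo%R ->
  sup_ratio PX PY mf @ \oo --> 0%E.
Proof.
move=> cX cY mXY mfoo; apply: sup_ratio_cvg0 => e e0.
have mXf n : (mX n <= mf n)%N by rewrite (leq_trans _ (mXY n))// leq_maxl.
have mYf n : (mY n <= mf n)%N by rewrite (leq_trans _ (mXY n))// leq_maxr.
have [c c0 kb] := kappa_dc_bounds cY.
have nX := concl_discrete_near cX mXf ltr01.
have nY := concl_discrete_continuous_near cY mYf ltr01.
case: cX => _ [a1 [a2 [a10 [a12 zXb]]]].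
case: cY => _ [b1 [b2 [b10 [b12 zYb]]]].
pose k := c / (1 + c); have k0 : 0 < k by rewrite divr_gt0// addr_gt0.
(* Once [ln m >= K * ln n], the summand 1 of [K] absorbs the error 1 (as [ln n >= 1]); the rest,
   multiplied by [kappa >= k], leaves [(a2 + 1) / e * ln n], which is the bound on [H(X)] divided by
   [e]. *)
pose K := (a2 + 1) / (e * k) + 1.
have a20 : 0 < a2 by exact: lt_le_trans a12.
have K1 : 1 < K.
  have : 0 < (a2 + 1) / (e * k) by apply: divr_gt0; [lra|exact: mulr_gt0].
  by rewrite /K; lra.
have nK : \forall n \near \oo, K <= ln (mf n)%:R / ln n%:R.
  by move/cvgryPge : mfoo; apply.
near=> n => m nm m0.
have n0 : (0 < n)%N by near: n; exact: nbhs_infty_gt.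
have lnn1 : 1 <= ln n%:R :> R by near: n; exact: ln_nat_near.
have zXn : zX n <= a2 * ln n%:R.
  by have [] : a1 * ln n%:R <= zX n /\ zX n <= a2 * ln n%:R by near: n.
have zYn : 0 <= zY n.
  have [+ _] : b1 * ln n%:R <= zY n /\ zY n <= b2 * ln n%:R by near: n.
  by apply: le_trans; rewrite mulr_ge0//; lra.
have HX : fine (Hmn PX m n) <= (a2 + 1) * ln n%:R.
  have : `|fine (Hmn PX m n) - zX n| < 1 by move: m nm m0; near: n; exact: nX.
  by rewrite ltr_norml => /andP[_]; lra.
have /andP[kn _] := kb n n0; rewrite -/k in kn.
have lmf : K * ln n%:R <= ln (mf n)%:R.
  have : K <= ln (mf n)%:R / ln n%:R by near: n.
  by rewrite ler_pdivlMr//; lra.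
have mf0 : (0 < mf n)%N.
  rewrite lt0n; apply/eqP => mf0; move: lmf.
  rewrite mf0 (ln0 (lexx 0)); apply/negP; rewrite -ltNge.
  by apply: mulr_gt0; lra.
have lm : ln (mf n)%:R <= ln m%:R :> R.
  by rewrite ler_ln ?posrE ?ltr0n// ler_nat.
have HY : (a2 + 1) / e * ln n%:R <= fine (Hmn PY m n).
  have : `|fine (Hmn PY m n) / kappa_dc nuY nudY n - (ln m%:R + zY n)| < 1.
    by move: m nm m0 {HX lm}; near: n; exact: nY.
  rewrite ltr_norml => /andP[+ _] => h.
  have kn0 : 0 < kappa_dc nuY nudY n by exact: lt_le_trans kn.
  have : (a2 + 1) / (e * k) * ln n%:R <= fine (Hmn PY m n) / kappa_dc nuY nudY n.
    by rewrite /K mulrDl mul1r in lmf; lra.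
  rewrite ler_pdivlMr//; apply: le_trans.
  have -> : (a2 + 1) / e * ln n%:R = (a2 + 1) / (e * k) * ln n%:R * k.
    by field; rewrite !gt_eqF.
  rewrite ler_pM2l//; apply: mulr_gt0; last by lra.
  by apply: divr_gt0; [lra|exact: mulr_gt0].
have HY0 : 0 < fine (Hmn PY m n).
  apply: lt_le_trans HY; apply: mulr_gt0; last by lra.
  by apply: divr_gt0; lra.
rewrite ler_pdivrMr// (le_trans HX)//.
have -> : (a2 + 1) * ln n%:R = e * ((a2 + 1) / e * ln n%:R).
  by field; rewrite gt_eqF.
by rewrite ler_pM2l.
Unshelve. all: by end_near. Qed.

Lemma ratio_dc_continuous nuX nudX PX PY mX mY mf zX zY :
  concl_discrete_continuous nuX nudX PX mX zX ->
  concl_continuous PY mY zY ->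
  (forall n, (maxn (mX n) (mY n) <= mf n)%N) ->
  (fun n : nat => ln (mf n)%:R / `|zY n| : R) @ \oo --> +oo%R ->
  sup_ratio PX PY mf @ \oo --> 0%E.
Proof.
move=> cX cY mXY mfoo; apply: sup_ratio_cvg0 => e e0.
have mXf n : (mX n <= mf n)%N by rewrite (leq_trans _ (mXY n))// leq_maxl.
have mYf n : (mY n <= mf n)%N by rewrite (leq_trans _ (mXY n))// leq_maxr.
have [c c0 kb] := kappa_dc_bounds cX.
have l2 : 0 < ln 2 :> R by rewrite ln_gt0// ltr1n.
have nX := concl_discrete_continuous_near cX mXf ltr01.
(* Tolerance [ln 2 / 4] is at most [ln m / 4] for [m >= 2]; together with [|zY n| <= ln m / 4] it
   leaves [H(Y) / n >= ln m / 2]. *)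
have nY := concl_continuous_near cY mYf (divr_gt0 l2 (ltr0n R 4)).
case: cX => _ [b1 [b2 [b10 [b12 zXb]]]].
have nK : \forall n \near \oo, 4 <= ln (mf n)%:R / `|zY n|.
  by move/cvgryPge : mfoo; apply.
have b20 : 0 < b2 by exact: lt_le_trans b12.
(* Half of [C] bounds [H(X) / (ln n * ln m)]: each logarithm is absorbed into the product by
   [ln n >= 1] and [ln m >= ln 2]. The factor 2 compensates the [1 / 2] in the lower bound on
   [H(Y)]. *)
pose C := 2 * c * (1 + (b2 + 1) / ln 2).
have C0 : 0 < C.
  have : 0 < (b2 + 1) / ln 2 by apply: divr_gt0 => //; lra.
  by move=> ?; apply: mulr_gt0; [exact: mulr_gt0|lra].
have nC : \forall n \near \oo, C * ln n%:R <= e * n%:R :> R.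
  near=> n.
  have n0 : 0 < n%:R :> R by rewrite ltr0n; near: n; exact: nbhs_infty_gt.
  have s0 : 0 < Num.sqrt n%:R :> R by rewrite sqrtr_gt0.
  have h : 2 * C / e <= Num.sqrt n%:R :> R.
    have Ce : 0 <= 2 * C / e by apply: divr_ge0; lra.
    rewrite -(@ler_pXn2r _ 2)// ?nnegrE ?(ltW s0)// sqr_sqrtr ?(ltW n0)//.
    by near: n; exact: nbhs_infty_ger.
  have l : ln n%:R <= 2 * Num.sqrt n%:R :> R.
    rewrite (ln_nat_sqrt n).
    have /le_ln1Dx : -1 < Num.sqrt n%:R - 1 :> R by lra.
    by rewrite addrC subrK; lra.
  apply: (@le_trans _ _ (C * (2 * Num.sqrt n%:R))); first by rewrite ler_pM2l.
  rewrite -{2}(sqr_sqrtr (ltW n0)).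
  move: h; rewrite ler_pdivrMr// => h.
  rewrite expr2 !mulrA ler_pM2r//; lra.
near=> n => m nm m0.
have n0 : (0 < n)%N by near: n; exact: nbhs_infty_gt.
have nR : 0 < n%:R :> R by rewrite ltr0n.
have lnn1 : 1 <= ln n%:R :> R by near: n; exact: ln_nat_near.
have zXn : zX n <= b2 * ln n%:R.
  by have [] : b1 * ln n%:R <= zX n /\ zX n <= b2 * ln n%:R by near: n.
have /andP[kn knc] := kb n n0.
have kn0 : 0 < kappa_dc nuX nudX n.
  by apply: lt_le_trans kn; rewrite divr_gt0// addr_gt0.
have K4 : 4 <= ln (mf n)%:R / `|zY n| by near: n.
(* If [zY n] were 0, the quotient in [K4] would be 0 by the convention for the inverse of 0. *)
have zY0 : 0 < `|zY n|.
  rewrite normr_gt0; apply/eqP => z0; move: K4.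
  by rewrite z0 normr0 invr0 mulr0; apply/negP; rewrite -ltNge.
have lmf : 4 * `|zY n| <= ln (mf n)%:R by move: K4; rewrite ler_pdivlMr.
have mf2 : (2 <= mf n)%N.
  move: lmf; case: (mf n) => [|[|//]] //.
    by rewrite ln0// => h; have := lt_le_trans (mulr_gt0 (ltr0n R 4) zY0) h; rewrite ltxx.
  by rewrite ln1// => h; have := lt_le_trans (mulr_gt0 (ltr0n R 4) zY0) h; rewrite ltxx.
have lm : ln (mf n)%:R <= ln m%:R :> R.
  by rewrite ler_ln ?posrE ?ltr0n ?ler_nat// (leq_trans _ mf2).
have lm2 : ln 2 <= ln m%:R :> R.
  by rewrite ler_ln ?posrE ?ltr0n ?ler_nat// (leq_trans mf2).
have lm0 : 0 < ln m%:R :> R by exact: lt_le_trans lm2.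
have HX : fine (Hmn PX m n) <= C / 2 * (ln n%:R * ln m%:R).
  have : `|fine (Hmn PX m n) / kappa_dc nuX nudX n - (ln m%:R + zX n)| < 1.
    by move: m nm m0 {lm lm2 lm0}; near: n; exact: nX.
  rewrite ltr_norml => /andP[_ h].
  have : fine (Hmn PX m n) / kappa_dc nuX nudX n <= ln m%:R + (b2 + 1) * ln n%:R.
    by lra.
  rewrite ler_pdivrMr// => /le_trans; apply.
  apply: (@le_trans _ _ ((ln m%:R + (b2 + 1) * ln n%:R) * c)).
    by rewrite ler_pM2l// addr_gt0// mulr_gt0//; lra.
  rewrite (_ : C / 2 = (1 + (b2 + 1) / ln 2) * c); last by rewrite /C; field; rewrite gt_eqF.
  rewrite mulrAC ler_pM2r// [leRHS]mulrDl mul1r lerD//.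
    by rewrite ler_peMl// ltW.
  have -> : (b2 + 1) / ln 2 * (ln n%:R * ln m%:R) = (b2 + 1) * ln n%:R * (ln m%:R / ln 2).
    by field; rewrite gt_eqF.
  rewrite ler_peMr ?mulr_ge0//; [lra|lra|].
  by rewrite ler_pdivlMr// mul1r.
have HY : n%:R * ln m%:R / 2 <= fine (Hmn PY m n).
  have [_] : Hmn PY m n \is a fin_num /\
      `|fine (Hmn PY m n) / n%:R - (ln m%:R + zY n)| < ln 2 / 4.
    by move: m nm m0 {HX lm lm2 lm0}; near: n; exact: nY.
  rewrite ltr_norml => /andP[h _].
  have := ler_norm (- zY n); rewrite normrN => hz.
  have : ln m%:R / 2 <= fine (Hmn PY m n) / n%:R by lra.
  by rewrite ler_pdivlMr//; lra.
have HY0 : 0 < fine (Hmn PY m n).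
  by apply: lt_le_trans HY; rewrite divr_gt0// mulr_gt0.
rewrite ler_pdivrMr// (le_trans HX)//.
apply: (@le_trans _ _ (e * (n%:R * ln m%:R / 2))); last by rewrite ler_pM2l.
have Cn : C * ln n%:R <= e * n%:R by near: n.
have : C * ln n%:R * ln m%:R <= e * n%:R * ln m%:R by rewrite ler_pM2r.
by lra.
Unshelve. all: by end_near. Qed.

End Ratio.

(** * Trigonometric estimates and the Fejer kernel *)

Section Trig.
Context {R : realType}.
Implicit Types x y : R.

Lemma norm_sin_le x : `|sin x| <= `|x|.
Proof.
wlog x0 : x / 0 <= x.
  move=> h; have [/h//|/ltW x0] := leP 0 x.
  by rewrite -normrN -sinN -[leRHS]normrN; apply: h; rewrite oppr_ge0.
have [c _] := MVT_segment x0 (fun z _ => is_derive_sin z)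
  (continuous_subspaceT (@continuous_sin R)).
rewrite sin0 !subr0 => ->; rewrite normrM ler_piMl//.
by rewrite ler_norml cos_geN1 cos_le1.
Qed.

Lemma onesubcosE x : 1 - cos x = 2 * sin (x / 2) ^+ 2.
Proof.
have -> : cos x = cos ((x / 2) *+ 2) by congr cos; rewrite -mulr_natr; field.
rewrite cos_mulr2n mulr2n; have := cos2Dsin2 (x / 2); lra.
Qed.

Lemma onesubcos_ge0 x : 0 <= 1 - cos x.
Proof. by rewrite subr_ge0 cos_le1. Qed.

Lemma onesubcos_le2 x : 1 - cos x <= 2.
Proof. by have := cos_geN1 x; lra. Qed.

Lemma onesubcos_le_sqr x : 1 - cos x <= x ^+ 2 / 2.
Proof.
have := norm_sin_le (x / 2); rewrite -(@ler_pXn2r _ 2)// ?nnegrE//.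
rewrite !real_normK ?num_real// onesubcosE exprMn; lra.
Qed.

Lemma onesubcos_le_norm x : 1 - cos x <= `|x|.
Proof.
rewrite onesubcosE; have h := norm_sin_le (x / 2).
have s1 : `|sin (x / 2)| <= 1 by rewrite ler_norml sin_geN1 sin_le1.
rewrite -real_normK ?num_real// expr2.
apply: (@le_trans _ _ (2 * `|sin (x / 2)|)).
  by rewrite ler_pM2l// ler_piMr.
move: h; rewrite normrM (ger0_norm (_ : 0 <= 2^-1))//; lra.
Qed.

Lemma norm_sinB_le x : `|sin x - x| <= x ^+ 2.
Proof.
wlog x0 : x / 0 <= x.
  move=> h; have [/h//|/ltW x0] := leP 0 x.
  have -> : `|sin x - x| = `|sin (- x) - - x| by rewrite sinN -opprD normrN.
  by rewrite -sqrrN; apply: h; rewrite oppr_ge0.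
have dv (z : R) : is_derive z 1 (fun u => sin u - u) (cos z - 1).
  by apply: is_derive_eq.
have cv : {within `[0, x], continuous (fun u : R => sin u - u)}.
  apply: continuous_subspaceT => z.
  exact/differentiable_continuous/derivable1_diffP/ex_derive.
have [c] := MVT_segment x0 (fun z _ => dv z) cv.
rewrite in_itv/= => /andP[c0 cx].
rewrite sin0 !subr0 => ->; rewrite normrM expr2 (ger0_norm x0).
rewrite ler_wpM2r// distrC ger0_norm ?onesubcos_ge0//.
by rewrite (le_trans (onesubcos_le_norm _))// ger0_norm.
Qed.

(* The Fejer kernel subtracted from its value at the origin. *)
Definition fejer_defect y : R :=
  if y == 0 then 0 else 2^-1 - (1 - cos y) / y ^+ 2.

Lemma fejer_defect_le_half y : fejer_defect y <= 2^-1.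
Proof.
rewrite /fejer_defect; case: eqVneq => // y0.
by rewrite lerBlDr lerDl divr_ge0 ?onesubcos_ge0 ?sqr_ge0.
Qed.

(** Since [1 - cos y <= 2], the subtracted term is at most [2 / 9]. This bound pays for each halving
    step in [ln_le_sum_fejer]. *)
Lemma fejer_defect_ge y : 3 <= `|y| -> 4^-1 <= fejer_defect y.
Proof.
move=> y3; have y0 : y != 0 by rewrite -normr_gt0; lra.
rewrite /fejer_defect (negPf y0).
have y9 : 9 <= y ^+ 2.
  rewrite -real_normK ?num_real//.
  by have := ler_pM (ler0n R 3) (ler0n R 3) y3 y3; rewrite expr2; lra.
have : (1 - cos y) / y ^+ 2 <= 2 / 9.
  rewrite ler_pdivrMr; last by lra.
  by have := onesubcos_le2 y; lra.
by lra.
Qed.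

(** The gap of [1 / 8] below the supremum [1 / 2] is what [prob_ball_le] converts into a bound on
    mass. It comes from [1 - cos y = 2 sin(y/2)^2] and [|sin(y/2)| >= |y| / 4]. *)
Lemma fejer_defect_le y : `|y| <= 1 -> fejer_defect y <= 3 / 8.
Proof.
rewrite /fejer_defect; case: eqVneq => [_ _|y0 y1]; first by lra.
suff : 8^-1 <= (1 - cos y) / y ^+ 2 by lra.
have y20 : 0 < y ^+ 2 by rewrite exprn_even_gt0.
rewrite ler_pdivlMr// onesubcosE.
have h := norm_sinB_le (y / 2).
have : `|y / 2| / 2 <= `|sin (y / 2)|.
  have : `|y / 2| <= `|sin (y / 2)| + `|sin (y / 2) - y / 2|.
    by rewrite -{1}(subKr (sin (y / 2)) (y / 2)) (le_trans (ler_normB _ _)).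
  have -> : `|y / 2| = `|y| / 2 by rewrite normrM (ger0_norm (_ : 0 <= 2^-1)).
  have : (y / 2) ^+ 2 <= `|y| / 4.
    rewrite -real_normK ?num_real// normrM (ger0_norm (_ : 0 <= 2^-1))//.
    have : `|y| * `|y| <= `|y| by rewrite ler_piMr.
    by rewrite expr2; lra.
  by lra.
rewrite -(@ler_pXn2r _ 2)// ?nnegrE// exprMn !real_normK ?num_real// exprMn.
lra.
Qed.

Lemma integral01_FTC (F f : R -> R) :
  (forall x, is_derive x 1 F (f x)) -> continuous f ->
  (\int[lebesgue_measure]_(x in `[0%R, 1%R]) (f x)%:E = (F 1 - F 0)%:E)%E.
Proof.
move=> dF cf.
have cF : continuous F.
  by move=> z; exact/differentiable_continuous/derivable1_diffP/ex_derive.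
rewrite (@continuous_FTC2 _ f F)//.
- exact: continuous_subspaceT.
- split => [x _|//|//]; first exact: ex_derive.
  + exact/cvg_at_right_filter/cF.
  + exact/cvg_at_left_filter/cF.
- by move=> x _; rewrite derive1E; exact: derive_val.
Qed.

Lemma integral_fejer_defect y :
  (\int[lebesgue_measure]_(u in `[0%R, 1%R]) ((1 - u) * (1 - cos (u * y)))%:E
   = (fejer_defect y)%:E)%E.
Proof.
have [->|y0] := eqVneq y 0.
  rewrite /fejer_defect eqxx integral0_eq// => u _.
  by rewrite mulr0 cos0 subrr mulr0.
(* Antiderivative found by integrating [(1 - u) * cos (u * y)] by parts. *)
pose F u : R := u - u ^+ 2 / 2 - ((1 - u) * sin (u * y) / y
  + (1 - cos (u * y)) / y ^+ 2).
have dF (u : R) : is_derive u 1 F ((1 - u) * (1 - cos (u * y))).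
  by apply: is_derive_eq; rewrite /GRing.scale/=; field.
rewrite (integral01_FTC dF).
- rewrite /F /fejer_defect (negPf y0) !mul0r !mul1r sin0 cos0; congr EFin.
  by field.
- move=> u; apply: cvgM; first by apply: cvgB => //; exact: cvg_cst.
  apply: cvgB; first exact: cvg_cst.
  apply: (@cvg_comp _ _ _ (fun u => u * y) cos); last exact: continuous_cos.
  by apply: cvgM => //; exact: cvg_cst.
Qed.

Lemma fejer_defect_ge0 y : 0 <= fejer_defect y.
Proof.
rewrite -lee_fin -integral_fejer_defect integral_ge0// => u/=.
rewrite in_itv/= => /andP[_ u1].
by rewrite lee_fin mulr_ge0 ?onesubcos_ge0// subr_ge0.
Qed.

Lemma integral01_onesub :
  (\int[lebesgue_measure]_(u in `[0%R, 1%R]) (1 - u)%:E = (2^-1 : R)%:E)%E.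
Proof.
have dF (u : R) : is_derive u 1 (fun u => u - u ^+ 2 / 2) (1 - u).
  by apply: is_derive_eq; rewrite /GRing.scale/=; field.
rewrite (integral01_FTC dF).
- by congr EFin; field.
- by move=> u; apply: cvgB => //; exact: cvg_cst.
Qed.

Lemma integral01_cauchy (b : R) : 0 < b ->
  (\int[lebesgue_measure]_(u in `[0%R, 1%R]) ((1 + (b * u) ^+ 2)^-1)%:E
    <= (2 / b)%:E)%E.
Proof.
move=> b0; have pos u : 0 < 1 + (b * u) ^+ 2 by rewrite ltr_wpDr ?sqr_ge0.
have dF (u : R) : is_derive u 1 (fun u => atan (b * u) / b) (1 + (b * u) ^+ 2)^-1.
  apply: is_derive_eq.
  by rewrite /GRing.scale/=; field; rewrite !gt_eqF.
rewrite (integral01_FTC dF).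
- rewrite mulr0 atan0 mul0r subr0 mulr1 lee_fin ler_pM2r ?invr_gt0//.
  have := atan_ltpi2 b; have [/andP[_ h] _] := @pihalf_02_cos_pihalf R; lra.
- move=> u; apply: cvgV; first by rewrite gt_eqF.
  apply: cvgD; first exact: cvg_cst.
  rewrite expr2; apply: cvgM; apply: cvgM => //; exact: cvg_cst.
Qed.

End Trig.

(** * Characteristic functions and concentration *)

Section Charfun.
Context {R : realType}.
Implicit Types (P : probability R R) (w t c : R).

Lemma measurable_cos_affine w c :
  measurable_fun [set: R] (fun x : R => cos (w * (x - c))).
Proof.
apply: continuous_measurable_fun => x.
apply: (@continuous_comp _ _ _ (fun x : R => w * (x - c)) cos); last exact: continuous_cos.
by apply: cvgM; [exact: cvg_cst | apply: cvgB => //; exact: cvg_cst].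
Qed.

Lemma measurable_sin_affine w :
  measurable_fun [set: R] (fun x : R => sin (w * x)).
Proof.
apply: continuous_measurable_fun => x.
apply: (@continuous_comp _ _ _ (fun x : R => w * x) sin); last exact: continuous_sin.
by apply: cvgM => //; exact: cvg_cst.
Qed.

Lemma integral_prob_cst P (r : \bar R) : (\int[P]_x (cst r x) = r)%E.
Proof.
rewrite integral_cst//.
have -> : (r * P setT = r * 1)%E by congr (_ * _)%E; exact: probability_setT.
by rewrite mule1.
Qed.

Lemma integrable_le1 P (f : R -> R) : measurable_fun [set: R] f ->
  (forall x, `|f x| <= 1) -> P.-integrable [set: R] (EFin \o f).
Proof.
move=> mf f1; apply: measurable_bounded_integrable => //.
  by rewrite (le_lt_trans (probability_le1 _ _)) ?ltry.
exists 1; split => // M M1 x _.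
exact: le_trans (f1 x) (ltW M1).
Qed.

Lemma integrable_cos_affine P w c :
  P.-integrable [set: R] (EFin \o (fun x : R => cos (w * (x - c)))).
Proof. by apply: integrable_le1; [exact: measurable_cos_affine|move=> x; exact: cos_max]. Qed.

(** Recentring at [c] multiplies the characteristic function by [exp(-iwc)]; this is the real part
    of the product. *)
Lemma Rintegral_cos_shift P w c :
  Rintegral P [set: R] (fun x => cos (w * (x - c))) =
  cos (w * c) * Rintegral P [set: R] (fun x => cos (w * x)) +
  sin (w * c) * Rintegral P [set: R] (fun x => sin (w * x)).
Proof.
have ic : P.-integrable [set: R] (EFin \o (fun x : R => cos (w * x))).
  have := integrable_cos_affine P w 0; congr (_.-integrable _ _).
  by apply/funext => x/=; rewrite subr0.
have isin : P.-integrable [set: R] (EFin \o (fun x : R => sin (w * x))).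
  by apply: integrable_le1; [exact: measurable_sin_affine|move=> x; exact: sin_max].
rewrite -!RintegralZl// -RintegralD//.
- by apply: eq_Rintegral => x _; rewrite mulrBr cosB; ring.
- exact: (integrableZl measurableT (cos (w * c)) ic).
- exact: (integrableZl measurableT (sin (w * c)) isin).
Qed.

(** Tonelli's theorem applied to the integral representation of [fejer_defect]; the measurability of
    both integrands is a by-product needed to compare these integrals later. *)
Lemma integral_fejer_defect_prob P t c :
  [/\ measurable_fun [set: R] (fun x : R => (fejer_defect (t * (x - c)))%:E),
   measurable_fun (`[0%R, 1%R]%classic : set R) (fun u : R =>
     ((1 - u) * (1 - Rintegral P [set: R] (fun x => cos (u * t * (x - c)))))%:E) &
   (\int[P]_x (fejer_defect (t * (x - c)))%:E =
   \int[lebesgue_measure]_(u in `[0%R, 1%R])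
     ((1 - u) * (1 - Rintegral P [set: R] (fun x => cos (u * t * (x - c)))))%:E)%E].
Proof.
(* The indicator and the absolute value make the integrand non-negative on the whole plane without
   changing it for [u] in [0, 1]. *)
pose g (z : R * R) : \bar R :=
  (\1_`[0%R, 1%R] z.2 * `|1 - z.2| * (1 - cos (z.2 * (t * (z.1 - c)))))%:E.
have mg : measurable_fun setT g.
  apply/measurable_EFinP; apply: measurable_funM.
    apply: measurable_funM.
      apply: (measurableT_comp (f := (\1_`[0%R, 1%R]%classic : R -> R)) _ measurable_snd).
      exact: measurable_indic.
    by apply: measurableT_comp => //; apply: measurable_funB.
  apply: measurable_funB => //.
  apply: measurableT_comp => //.
    by apply: continuous_measurable_fun; exact: continuous_cos.
  by apply: measurable_funM => //; apply: measurable_funM => //; apply: measurable_funB.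
have g0 z : (0 <= g z)%E.
  by rewrite lee_fin !mulr_ge0 ?onesubcos_ge0// indicE.
have gE (f : R -> R) : (\int[lebesgue_measure]_u
     (\1_`[0%R, 1%R] u * `|1 - u| * f u)%:E =
   \int[lebesgue_measure]_(u in `[0%R, 1%R]) ((1 - u) * f u)%:E)%E.
  rewrite [in RHS]integral_mkcond; apply: eq_integral => u _.
  rewrite patchE indicE; case: ifPn => [|_]; last by rewrite !mul0r.
  by rewrite inE/= in_itv/= => /andP[_ u1]; rewrite mul1r ger0_norm// subr_ge0.
have KE : (fun x => (fejer_defect (t * (x - c)))%:E) =
    (fun x => \int[lebesgue_measure]_u g (x, u))%E.
  by apply/funext => x; rewrite -integral_fejer_defect -gE.
have GE : (fun u => \int[P]_x g (x, u))%E = (fun u => (\1_`[0%R, 1%R] u * `|1 - u| *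
    (1 - Rintegral P [set: R] (fun x => cos (u * t * (x - c)))))%:E).
  apply/funext => u; rewrite /g/=.
  set a : R := \1_`[0%R, 1%R] u * `|1 - u|.
  under eq_integral => x _ do rewrite EFinM mulrA EFinB.
  have ic := integrable_cos_affine P (u * t) c.
  have i1 : P.-integrable [set: R] (EFin \o cst 1).
    by apply: integrable_le1 => // x; rewrite normr1.
  rewrite integralZl//; last exact: integrableB.
  rewrite integralB_EFin// integral_prob_cst.
  rewrite -[X in (_ - X)%E]fineK; last exact: integrable_fin_num.
  by rewrite -EFinB -EFinM.
split.
- rewrite KE.
  exact: (measurable_fun_fubini_tonelli_F (m2 := lebesgue_measure) g mg g0).
- have := measurable_fun_fubini_tonelli_G (m1 := P) g mg g0.
  rewrite /fubini_G GE => mG.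
  apply: (eq_measurable_fun _ _ (measurable_funTS mG)) => u; rewrite inE/= => u01.
  rewrite indicE mem_set// mul1r ger0_norm// subr_ge0.
  by move: u01; rewrite in_itv/= => /andP[].
- rewrite KE -gE.
  apply: etrans (fubini_tonelli (m1 := P) (m2 := lebesgue_measure) g mg g0) _.
  by apply: eq_integral => u _; exact: (congr1 (@^~ u) GE).
Qed.

Lemma Rintegral_cos_itv P w c :
  -1 <= Rintegral P [set: R] (fun x => cos (w * (x - c))) <= 1.
Proof.
rewrite -ler_norml.
have ic := integrable_cos_affine P w c.
apply: le_trans (le_normr_Rintegral measurableT ic) _.
have i1 : P.-integrable [set: R] (EFin \o cst 1).
  by apply: integrable_le1 => // x; rewrite normr1.
have <- : Rintegral P [set: R] (cst 1) = 1.
  by rewrite /Rintegral (integral_prob_cst P 1%:E).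
apply: le_Rintegral => //; last by move=> x _; exact: cos_max.
apply: integrable_le1; last by move=> x; rewrite normr_id cos_max.
by apply: measurableT_comp => //; exact: measurable_cos_affine.
Qed.

Lemma fejer_defect_mean_le P t (B : R) : 0 <= t ->
  (forall w, 0 <= w <= t ->
     1 - Rintegral P [set: R] (fun x => cos (w * x)) <= B) ->
  (\int[P]_x (fejer_defect (t * x))%:E <= B%:E)%E.
Proof.
move=> t0 hB; have [_ mu h] := integral_fejer_defect_prob P t 0.
have -> : (\int[P]_x (fejer_defect (t * x))%:E =
           \int[P]_x (fejer_defect (t * (x - 0)))%:E)%E.
  by apply: eq_integral => x _; rewrite subr0.
rewrite h; apply: (@le_trans _ _ (\int[lebesgue_measure]_(u in `[0%R, 1%R]) (cst B%:E u))%E).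
  apply: ge0_le_integral => //.
    move=> u /=; rewrite in_itv/= => /andP[u0 u1].
    rewrite lee_fin mulr_ge0 ?subr_ge0//.
    by have /andP[] := Rintegral_cos_itv P (u * t) 0.
  move=> u /=; rewrite in_itv/= => /andP[u0 u1]; rewrite lee_fin.
  have /andP[_ c1] := Rintegral_cos_itv P (u * t) 0.
  have -> : (fun x => cos (u * t * (x - 0))) = (fun x : R => cos (u * t * x)).
    by apply/funext => x; rewrite subr0.
  apply: le_trans (hB (u * t) _); last by rewrite mulr_ge0//= ler_piMl.
  rewrite ler_piMl//; last by lra.
  rewrite subr_ge0; move: c1; congr (_ <= _); apply: eq_Rintegral => x _.
  by rewrite subr0.
rewrite integral_cst//= lebesgue_measure_itv/= lte_fin ltr01 oppr0 adde0 mule1.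
exact: lexx.
Qed.

Lemma measurable_norm_affine t c : measurable [set x : R | `|t * (x - c)| <= 1].
Proof.
have mf : measurable_fun [set: R] (fun x : R => `|t * (x - c)|).
  apply: measurableT_comp => //; apply: measurable_funM => //.
  exact: measurable_funB.
have := mf measurableT `]-oo, 1]%classic (measurable_itv _).
by rewrite setTI.
Qed.

(* Smoothing inequality: an integrable bound on the characteristic function
   bounds the mass of short intervals. *)
Lemma prob_ball_le P c t (b : R) : 0 < t -> 0 < b ->
  (forall u : R, 0 <= u <= 1 ->
    Rintegral P [set: R] (fun x => cos (u * t * (x - c))) <=
      (1 + (b * u) ^+ 2)^-1) ->
  fine (P [set x : R | `|t * (x - c)| <= 1]) <= 16 / b.
Proof.
move=> t0 b0 hb; have [mK mu h] := integral_fejer_defect_prob P t c.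
pose A := [set x : R | `|t * (x - c)| <= 1].
have mA : measurable A by exact: measurable_norm_affine.
have K0 x : (0 <= (fejer_defect (t * (x - c)))%:E)%E.
  by rewrite lee_fin; exact: fejer_defect_ge0.
(* Pointwise, the defect is at most [3 / 8] on [A] and at most [1 / 2] elsewhere. *)
have le1 : ((8^-1)%:E * P A + \int[P]_x (fejer_defect (t * (x - c)))%:E <= (2^-1)%:E)%E.
  rewrite -[in X in (X + _)%E](setIT A) -integral_indic//.
  rewrite -ge0_integralZl//; last by apply/measurable_EFinP; exact: measurable_indic.
  rewrite -ge0_integralD//.
  - apply: (@le_trans _ _ (\int[P]_x cst (2^-1)%:E x)%E); last first.
      by rewrite integral_prob_cst.
    apply: ge0_le_integral => //.
    + by move=> x _; rewrite adde_ge0// mule_ge0// lee_fin.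
    + apply: emeasurable_funD => //; apply: measurable_funeM.
      by apply/measurable_EFinP; exact: measurable_indic.
    + move=> x _; rewrite /= lee_fin indicE.
      case: (boolP (x \in A)) => [|_]; last by rewrite mulr0 add0r fejer_defect_le_half.
      by rewrite inE/= => /fejer_defect_le; lra.
  - apply: measurable_funeM.
    by apply/measurable_EFinP; exact: measurable_indic.
(* Here [1 / 2] is the integral of [1 - u], split as [(1 - u) * p + (1 - u) * (1 - p)] with [p] the
   real part of the characteristic function. With [le1], this gives [P A / 8 <= 2 / b]. *)
have le2 : ((2^-1)%:E <= (2 / b)%:E + \int[P]_x (fejer_defect (t * (x - c)))%:E)%E.
  apply: (@le_trans _ _
    (\int[lebesgue_measure]_(u in `[0%R, 1%R]) ((1 + (b * u) ^+ 2)^-1)%:E +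
     \int[P]_x (fejer_defect (t * (x - c)))%:E)%E); last first.
    by rewrite leeD2r// integral01_cauchy.
  have mq : measurable_fun (`[0%R, 1%R]%classic : set R)
      (fun u => ((1 + (b * u) ^+ 2)^-1)%:E).
    apply/measurable_EFinP; apply: measurable_funTS.
    apply: continuous_measurable_fun => u; apply: cvgV.
      by rewrite gt_eqF// ltr_wpDr ?sqr_ge0.
    apply: cvgD; first exact: cvg_cst.
    by rewrite expr2; apply: cvgM; apply: cvgM => //; exact: cvg_cst.
  have q0 u : 0 <= (1 + (b * u) ^+ 2)^-1.
    by rewrite invr_ge0 addr_ge0// sqr_ge0.
  rewrite h -ge0_integralD//.
  - rewrite -integral01_onesub; apply: ge0_le_integral => //.
    + by move=> u /=; rewrite in_itv/= => /andP[_ u1]; rewrite lee_fin subr_ge0.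
    + by apply/measurable_EFinP; exact: measurable_funB.
    + exact: emeasurable_funD.
    + move=> u /=; rewrite in_itv/= => /andP[u0 u1]; rewrite lee_fin.
      have := hb u; rewrite u0 u1 => /(_ isT).
      set q := _^-1; set p := Rintegral _ _ _ => pq.
      have : (1 - u) * p <= q.
        apply: (@le_trans _ _ ((1 - u) * q)).
          by rewrite ler_wpM2l// subr_ge0.
        by rewrite ler_piMl ?q0//; lra.
      by lra.
  - by move=> u _; rewrite lee_fin.
  - move=> u /=; rewrite in_itv/= => /andP[u0 u1].
    rewrite lee_fin mulr_ge0 ?subr_ge0//.
    by have /andP[] := Rintegral_cos_itv P (u * t) c.
have I0 : (0 <= \int[P]_x (fejer_defect (t * (x - c)))%:E)%E by exact: integral_ge0.
have Pf : P A \is a fin_num by exact: fin_num_measure.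
move: le1 le2 I0; rewrite -/A -(fineK Pf).
case: (\int[P]_x (fejer_defect (t * (x - c)))%:E)%E => [r| |]//.
rewrite -EFinM -!EFinD !lee_fin => r1 r2 _ /=.
have -> : 16 / b = 8 * (2 / b) by ring.
by lra.
Qed.

End Charfun.

(** * Lower bound for the Gaussian entropy *)

Section EntropyLower.
Context {R : realType}.

(** The points [k / m] with [|k| <= N], indexed by [i = k + N]: finite truncations exhausting the
    range of [quant m]. *)
Definition quant_grid (m N : nat) : set R :=
  [set m%:R^-1 * (i%:Z - N%:Z)%:~R | i in `I_(N.*2.+1)].

Lemma quant_grid_cvg (P : probability R R) m :
  (fun N => P (\bigcup_(y in quant_grid m N) (quant m @^-1` [set y]))) @ \oo --> 1%E.
Proof.
pose U N := \bigcup_(y in quant_grid m N) (quant m @^-1` [set y]).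
have UT : \bigcup_N U N = [set: R].
  apply/seteqP; split => // x _.
  pose k := Num.floor (2^-1 + m%:R * x).
  exists `|k|%N => //; exists (quant m x) => //.
  exists (absz (k + `|k|%N%:Z)); first by rewrite /=; lia.
  by rewrite /quant -/k; congr (_ * _%:~R); lia.
have mU N : measurable (U N).
  apply: fin_bigcup_measurable; first exact/finite_image/finite_II.
  by move=> y _; exact: measurable_quant_cell.
have ndU : {homo U : n k / (n <= k)%N >-> (n <= k)%O}.
  move=> n k nk; apply/subsetPset => x [_ [i /= iN <-] xi].
  exists (m%:R^-1 * (i%:Z - n%:Z)%:~R) => //.
  exists (i + (k - n))%N; first by rewrite /=; lia.
  by congr (_ * _%:~R); lia.
have := nondecreasing_cvg_mu mU _ ndU.
rewrite UT => /(_ _ P measurableT).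
by rewrite [X in _ --> X](_ : _ = 1%E)//; exact: probability_setT.
Qed.

(** A cell of mass [p <= K] contributes [- p * ln p >= p * (- ln K)]. Summing over finite grids and
    letting their mass tend to 1 gives the bound. *)
Lemma entropy_quant_ge (P : probability R R) m (K : R) : 0 < K ->
  (forall y, fine (P (quant m @^-1` [set y])) <= K) ->
  ((- ln K)%:E <= entropy_quant P m)%E.
Proof.
move=> K0 hK; have [s0|s0] := leP (- ln K) 0.
  by rewrite (le_trans _ (entropy_quant_ge0 P m))// lee_fin.
have key N : ((- ln K)%:E * P (\bigcup_(y in quant_grid m N) (quant m @^-1` [set y]))
    <= entropy_quant P m)%E.
  have fg : finite_set (quant_grid m N) by exact/finite_image/finite_II.
  apply: esum_ge; exists (quant_grid m N); first by split.
  rewrite measure_fin_bigcup//.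
  - rewrite ge0_mule_fsumr//; apply: lee_fsum => // y _.
    have mc := measurable_quant_cell m y.
    have /andP[p0 _] := probability_fine_itv P mc.
    rewrite -[X in (_ * X)%E]fineK; last exact: fin_num_measure.
    rewrite -EFinM lee_fin /negplogp mulrC -mulrN.
    move: p0; rewrite le_eqVlt => /predU1P[<-|p0]; first by rewrite !mul0r.
    by rewrite ler_pM2l// lerN2 ler_ln// posrE.
  - by apply: trivIset_preimage1.
  - by move=> y _; exact: measurable_quant_cell.
have cv := cvgeZl (isT : (- ln K)%:E \is a fin_num) (@quant_grid_cvg P m).
rewrite -[X in (X <= _)%E]mule1 -(cvg_lim _ cv)//.
apply: lime_le; first by apply/cvg_ex; eexists; exact: cv.
by apply: nearW => N; exact: key.
Qed.

Lemma quant_cell_sub m (y : R) : (0 < m)%N ->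
  quant m @^-1` [set y] `<=` [set x : R | `|(2 * m%:R) * (x - y)| <= 1].
Proof.
move=> m0 x /= <-; rewrite /quant.
have mR : 0 < m%:R :> R by rewrite ltr0n.
have := floor_itv (2^-1 + m%:R * x); rewrite intrD => /andP[].
set k : R := _%:~R => h1 h2.
have -> : 2 * m%:R * (x - m%:R^-1 * k) = 2 * (m%:R * x - k).
  by field; rewrite gt_eqF.
by rewrite ler_norml; apply/andP; split; lra.
Qed.

(** At frequency [2 * m * u] the characteristic function has modulus [exp(-2 (bu)^2)] with
    [b = s * m / sqrt n], below the Cauchy profile required by [prob_ball_le]. Every cell thus has
    mass at most [16 / b]. *)
Lemma gaussian_entropy_quant_ge (mu s : R) (nu : {measure set R -> \bar R}) n
    (P : probability R R) m : (0 < n)%N -> (0 < m)%N -> 0 < s ->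
  (forall A, nu A = 0%E) -> law_of_increment mu s nu n P ->
  ((ln m%:R - ln n%:R / 2 + ln (s / 16))%:E <= entropy_quant P m)%E.
Proof.
move=> n0 m0 s0 nu0 law.
have nR : 0 < n%:R :> R by rewrite ltr0n.
have mR : 0 < m%:R :> R by rewrite ltr0n.
have sq0 : 0 < Num.sqrt n%:R :> R by rewrite sqrtr_gt0.
pose b := s * m%:R / Num.sqrt n%:R; have b0 : 0 < b by rewrite divr_gt0 ?mulr_gt0.
have -> : ln m%:R - ln n%:R / 2 + ln (s / 16) = - ln (16 / b).
  have -> : 16 / b = (m%:R * (s / 16) / Num.sqrt n%:R)^-1.
    by rewrite /b; field; rewrite !gt_eqF.
  rewrite lnV ?posrE ?opprK ?divr_gt0 ?mulr_gt0 ?divr_gt0//.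
  rewrite [RHS]ln_div ?posrE ?mulr_gt0 ?divr_gt0// (@lnM _ m%:R) ?posrE ?divr_gt0//.
  rewrite (ln_nat_sqrt n).
  by lra.
apply: entropy_quant_ge; first by rewrite divr_gt0.
move=> y; have mc := measurable_quant_cell m y.
have hb (u : R) : 0 <= u <= 1 ->
    Rintegral P [set: R] (fun x => cos (u * (2 * m%:R) * (x - y))) <=
    (1 + (b * u) ^+ 2)^-1.
  move=> _; rewrite Rintegral_cos_shift.
  have [-> ->] := law (u * (2 * m%:R)).
  (* Drift and recentring combine into one cosine, bounded by 1 below, so the estimate is uniform in
     [mu] and [y]. *)
  rewrite !(mulrCA _ (expR _)) -mulrDr -cosB.
  have -> : levy_exp_re s nu (u * (2 * m%:R)) / n%:R = - (2 * (b * u) ^+ 2).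
    rewrite /levy_exp_re /Rintegral (eq_measure_integral mzero); last first.
      by move=> A _ _; exact: nu0.
    rewrite integral_measure_zero addr0 /b !exprMn exprVn sqr_sqrtr ?ltW//.
    by field; rewrite gt_eqF.
  apply: (@le_trans _ _ (expR (- (2 * (b * u) ^+ 2)))).
    by rewrite ler_piMr ?expR_ge0 ?cos_le1.
  have q0 := sqr_ge0 (b * u).
  rewrite expRN lef_pV2 ?posrE ?expR_gt0//; last by lra.
  by apply: le_trans (expR_ge1Dx _); lra.
apply: le_trans (prob_ball_le _ b0 hb); last by rewrite mulr_gt0.
have mB := @measurable_norm_affine R (2 * m%:R) y.
rewrite fine_le ?fin_num_measure//.
by apply: le_measure; rewrite ?inE//; exact: quant_cell_sub.
Qed.

End EntropyLower.

(** * Growth of the Levy exponent *)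

Section LevyBound.
Context {R : realType}.
Implicit Types (a r theta x : R) (nu : {measure set R -> \bar R}).

(** A single majorant for the Levy integrands, quadratic near 0 and of order [|a|^theta] in the
    tails, merging the two integrability conditions of [levy_measure]. *)
Definition levy_weight theta a : R :=
  Num.min 1 (a ^+ 2) + \1_[set a : R | 1 < `|a|] a * `|a| `^ theta.

Lemma measurable_norm_gt1 : measurable [set a : R | 1 < `|a|].
Proof.
have := @normr_measurable R setT measurableT `]1, +oo[%classic (measurable_itv _).
rewrite setTI; congr measurable; apply/seteqP; split => a /=;
  by rewrite in_itv/= andbT.
Qed.

Lemma measurable_levy_weight theta : measurable_fun [set: R] (levy_weight theta).
Proof.
apply: measurable_funD.
  by apply: measurable_minr => //; exact: measurable_funX.
apply: measurable_funM; first exact: measurable_indic measurable_norm_gt1.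
by apply: (measurableT_comp (measurable_powR _)).
Qed.

Lemma levy_weight_ge0 theta a : 0 <= levy_weight theta a.
Proof.
rewrite addr_ge0// ?mulr_ge0 ?powR_ge0//.
by rewrite le_min ler01 sqr_ge0.
Qed.

Lemma levy_weight_lt1 theta a : `|a| < 1 -> a ^+ 2 <= levy_weight theta a.
Proof.
move=> a1; rewrite /levy_weight.
have a2 : a ^+ 2 <= 1 by rewrite -real_normK ?num_real// exprn_ile1// ltW.
by rewrite (min_idPr a2) lerDl mulr_ge0 ?powR_ge0.
Qed.

Lemma levy_weight_ge1 theta a : 1 <= `|a| -> `|a| `^ theta <= levy_weight theta a.
Proof.
(* At [|a| = 1] the indicator vanishes and the minimum supplies the value 1. *)
rewrite le_eqVlt => /predU1P[a1|a1]; rewrite /levy_weight.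
  rewrite -a1 powR1 (_ : a ^+ 2 = 1); last by rewrite -real_normK ?num_real// -a1 expr1n.
  by rewrite minxx lerDl mulr_ge0.
rewrite indicE mem_set// mul1r lerDr le_min ler01/= sqr_ge0//.
Qed.

Lemma levy_measure_weight nu : levy_measure nu -> exists theta M : R,
  [/\ 0 < theta, theta <= 1, 0 <= M &
      (\int[nu]_a (levy_weight theta a)%:E <= M%:E)%E].
Proof.
move=> [_ [i1 [theta0 [t0 i2]]]].
(* Lowering the exponent decreases the integrand where [|a| > 1], and [theta <= 1] gives
   [|x| <= |x|^theta] for [|x| <= 1]. *)
pose theta := Num.min theta0 1.
have th0 : 0 < theta by rewrite lt_min t0 ltr01.
have i2' : (\int[nu]_(a in [set a : R | (1 < `|a|)%R]) (powR `|a|%R theta)%:E < +oo)%E.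
  apply: le_lt_trans i2; apply: ge0_le_integral => //.
  - exact: measurable_norm_gt1.
  - apply/measurable_EFinP/measurable_funTS.
    by apply: (measurableT_comp (measurable_powR _)).
  - apply/measurable_EFinP/measurable_funTS.
    by apply: (measurableT_comp (measurable_powR _)).
  - by move=> a /= a1; rewrite lee_fin ler_powR ?ge_min ?lexx// ltW.
have mn0 a : 0 <= Num.min 1 (a ^+ 2) by rewrite le_min ler01 sqr_ge0.
have E : (\int[nu]_a (levy_weight theta a)%:E =
   \int[nu]_(a in [set: R]) (Num.min 1 (a ^+ 2))%:E +
   \int[nu]_(a in [set a : R | (1 < `|a|)%R]) (powR `|a|%R theta)%:E)%E.
  rewrite [in X in (_ + X)%E]integral_mkcond -ge0_integralD//.
  - apply: eq_integral => a _; rewrite /levy_weight EFinD patchE indicE.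
    by case: ifPn => _; rewrite ?mul1r ?mul0r.
  - by move=> a _; rewrite lee_fin.
  - apply/measurable_EFinP; apply: measurable_minr => //; exact: measurable_funX.
  - by move=> a _; rewrite patchE; case: ifPn; rewrite ?lee_fin ?powR_ge0.
  - apply/(measurable_restrict _ measurable_norm_gt1 measurableT); rewrite setTI.
    apply/measurable_EFinP/measurable_funTS.
    by apply: (measurableT_comp (measurable_powR _)).
have I0 : (0 <= \int[nu]_a (levy_weight theta a)%:E)%E.
  by apply: integral_ge0 => a _; rewrite lee_fin levy_weight_ge0.
have Ify : (\int[nu]_a (levy_weight theta a)%:E < +oo)%E.
  by rewrite E; exact: lte_add_pinfty.
exists theta, (fine (\int[nu]_a (levy_weight theta a)%:E)%E); split => //.
- by rewrite ge_min lexx orbT.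
- exact: fine_ge0.
- by rewrite fineK// ge0_fin_numE.
Qed.

Lemma Rintegral_le_weight nu (f : R -> R) (k theta M : R) : 0 <= k ->
  measurable_fun [set: R] f ->
  (forall a, `|f a| <= k * levy_weight theta a) ->
  (\int[nu]_a (levy_weight theta a)%:E <= M%:E)%E ->
  `|Rintegral nu [set: R] f| <= k * M.
Proof.
move=> k0 mf fk IM.
have mfE : measurable_fun [set: R] (EFin \o f) by exact/measurable_EFinP.
have mw : measurable_fun [set: R] (fun a => (levy_weight theta a)%:E).
  by apply/measurable_EFinP; exact: measurable_levy_weight.
have le : (`|\int[nu]_a (f a)%:E| <= (k * M)%:E)%E.
  apply: le_trans (le_abse_integral _ measurableT mfE) _.
  apply: (@le_trans _ _ (\int[nu]_a (k%:E * (levy_weight theta a)%:E))%E).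
    apply: ge0_le_integral => //.
    - exact: measurableT_comp.
    - exact: measurable_funeM.
    - by move=> a _; rewrite /= -EFinM lee_fin.
  rewrite ge0_integralZl//; last by move=> a _; rewrite lee_fin levy_weight_ge0.
  by rewrite EFinM lee_wpmul2l.
rewrite /Rintegral; move: le; case: (\int[nu]_a _)%E => [r| |] //=.
Qed.

Lemma norm_le_powR x theta : 0 < theta <= 1 -> `|x| <= 1 -> `|x| <= `|x| `^ theta.
Proof.
move=> /andP[t0 t1] x1; have [->|x0] := eqVneq x 0; first by rewrite normr0 powR_ge0.
by rewrite ger1_powR// normr_gt0 x0.
Qed.

Lemma one_le_powR x theta : 0 < theta -> 1 <= `|x| -> 1 <= `|x| `^ theta.
Proof. by move=> t0 x1; rewrite -[leLHS](powRr0 `|x|) ler_powR// ltW. Qed.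

Lemma onesubcos_le_powR x theta : 0 < theta <= 1 -> 1 - cos x <= 2 * `|x| `^ theta.
Proof.
move=> t; have /andP[t0 t1] := t; have [x1|/ltW x1] := leP `|x| 1.
  have := norm_le_powR t x1; have := onesubcos_le_norm x.
  by have := powR_ge0 `|x| theta; lra.
by have := one_le_powR t0 x1; have := onesubcos_le2 x; lra.
Qed.

Lemma norm_sin_le_powR x theta : 0 < theta <= 1 -> `|sin x| <= `|x| `^ theta.
Proof.
move=> t; have /andP[t0 t1] := t; have [x1|/ltW x1] := leP `|x| 1.
  by rewrite (le_trans (norm_sin_le x))// norm_le_powR.
by rewrite (le_trans (sin_max x))// one_le_powR.
Qed.

(** * Levy integrands at the frequencies [r * sqrt n], with r in [0, 1] *)

Section Increment.
Variables (n : nat) (r theta : R).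
Hypotheses (n0 : (0 < n)%N) (r01 : 0 <= r <= 1) (t01 : 0 < theta <= 1).
Let w := r * Num.sqrt n%:R.

Let nR : 1 <= n%:R :> R. Proof. by rewrite ler1n. Qed.

Let sq1 : 1 <= Num.sqrt n%:R :> R.
Proof. by rewrite -[leLHS]sqrtr1 ler_sqrt. Qed.

Let sqn : Num.sqrt n%:R <= n%:R :> R.
Proof.
by rewrite -[leRHS](sqr_sqrtr (ler0n R n)) expr2 ler_peMr.
Qed.

Lemma sqr_le_powR : r ^+ 2 <= r `^ theta.
Proof.
have /andP[r0 r1] := r01.
have := @norm_le_powR r theta t01; rewrite ger0_norm// => /(_ r1).
by apply: le_trans; rewrite expr2 ler_piMr.
Qed.

Let w0 : 0 <= w. Proof. by rewrite mulr_ge0//; case/andP: r01. Qed.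

(** Squaring [sqrt n] produces exactly the factor [n] that dividing the exponent by [n] cancels. *)
Lemma scaled_sqr_le a : `|a| < 1 ->
  (w * a) ^+ 2 <= n%:R * r `^ theta * levy_weight theta a.
Proof.
move=> a1; rewrite /w !exprMn sqr_sqrtr// (mulrC (r ^+ 2)).
apply: ler_pM; [by apply: mulr_ge0 => //; exact: sqr_ge0|exact: sqr_ge0| |].
  by rewrite ler_wpM2l// sqr_le_powR.
exact: levy_weight_lt1.
Qed.

(** For large jumps the factor [n] is generous: [(sqrt n)^theta <= sqrt n <= n] because
    [theta <= 1]. *)
Lemma scaled_powR_le a : 1 <= `|a| ->
  `|w * a| `^ theta <= n%:R * r `^ theta * levy_weight theta a.
Proof.
move=> a1; have /andP[r0 r1] := r01; have /andP[t0 t1] := t01.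
rewrite normrM (ger0_norm w0) /w !powRM ?mulr_ge0// (mulrC (r `^ theta)).
apply: ler_pM; rewrite ?mulr_ge0 ?powR_ge0//.
  rewrite ler_wpM2r ?powR_ge0// (le_trans _ sqn)//.
  exact: ler1_powR.
exact: levy_weight_ge1.
Qed.

Lemma norm_cosB1_le_weight a :
  `|cos (w * a) - 1| <= n%:R * (2 * r `^ theta) * levy_weight theta a.
Proof.
rewrite distrC ger0_norm ?onesubcos_ge0//.
have -> : n%:R * (2 * r `^ theta) * levy_weight theta a =
  2 * (n%:R * r `^ theta * levy_weight theta a) by ring.
have [a1|a1] := ltP `|a| 1.
  have := scaled_sqr_le a1; have := onesubcos_le_sqr (w * a).
  by have := sqr_ge0 (w * a); lra.
have := scaled_powR_le a1; have := onesubcos_le_powR (w * a) t01; lra.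
Qed.

(** For [|a| < 1] the compensator removes the linear term of the sine, leaving a quadratic
    remainder; for larger jumps the sine itself is below the power. *)
Lemma norm_sin_comp_le_weight a :
  `|sin (w * a) - (if `|a| < 1 then w * a else 0)| <=
  n%:R * (2 * r `^ theta) * levy_weight theta a.
Proof.
have -> : n%:R * (2 * r `^ theta) * levy_weight theta a =
  2 * (n%:R * r `^ theta * levy_weight theta a) by ring.
case: ltP => a1.
  have := scaled_sqr_le a1; have := norm_sinB_le (w * a).
  by have := sqr_ge0 (w * a); lra.
rewrite subr0; have := scaled_powR_le a1; have := norm_sin_le_powR (w * a) t01.
by have := normr_ge0 (sin (w * a)); lra.
Qed.

End Increment.

(** Split the left side as [(1 - exp x) + exp x * (1 - cos y)]. *)
Lemma onesub_expRcos_le (x y : R) : x <= 0 -> 1 - expR x * cos y <= `|x| + `|y|.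
Proof.
move=> x0; have := expR_ge1Dx x; have := onesubcos_le_norm y.
have := onesubcos_ge0 y; have e1 : expR x <= 1 by rewrite -(expR0 R) ler_expR.
move=> c0 cy ex.
have : expR x * (1 - cos y) <= 1 - cos y by rewrite ler_piMl.
by rewrite ler0_norm//; lra.
Qed.

(* Uniformity in [n] makes [sqrt n] the worst scaling among all Levy noises. *)
Lemma levy_charfun_le (mu s : R) nu : levy_measure nu ->
  exists theta C : R, [/\ 0 < theta, theta <= 1, 0 <= C &
    forall n (P : probability R R) r, (0 < n)%N -> 0 <= r <= 1 ->
      law_of_increment mu s nu n P ->
      1 - Rintegral P [set: R] (fun x => cos (r * Num.sqrt n%:R * x)) <=
        C * r `^ theta].
Proof.
move=> /levy_measure_weight[theta [M [t0 t1 M0 IM]]].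
have t01 : 0 < theta <= 1 by rewrite t0.
(* The Gaussian term gives [s^2 / 2], the drift [|mu|], and the jump integrals in the real and
   imaginary exponents [2 * M] each. *)
exists theta, (s ^+ 2 / 2 + `|mu| + 4 * M); split => //.
  have := sqr_ge0 s; have := normr_ge0 mu; lra.
move=> n P r n0 r01 law; have /andP[r0 r1] := r01.
have nR : 0 < n%:R :> R by rewrite ltr0n.
have [-> _] := law (r * Num.sqrt n%:R).
set w := r * Num.sqrt n%:R.
have p0 := powR_ge0 r theta.
have k0 : 0 <= n%:R * (2 * r `^ theta) by rewrite !mulr_ge0.
have rp : r <= r `^ theta.
  by have := @norm_le_powR r theta t01; rewrite ger0_norm//; apply.
have cosb : `|Rintegral nu [set: R] (fun a => cos (w * a) - 1)| <=
    n%:R * (2 * r `^ theta) * M.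
  apply: (Rintegral_le_weight k0 _ (norm_cosB1_le_weight n0 r01 t01) IM).
  apply: measurable_funB => //.
  have := measurable_cos_affine w 0.
  by under eq_fun do rewrite subr0.
have sinb : `|Rintegral nu [set: R]
      (fun a => sin (w * a) - (if `|a| < 1 then w * a else 0))| <=
    n%:R * (2 * r `^ theta) * M.
  apply: (Rintegral_le_weight k0 _ (norm_sin_comp_le_weight n0 r01 t01) IM).
  apply: measurable_funB; first exact: measurable_sin_affine.
  apply: measurable_fun_ifT => //.
  by apply: measurable_fun_ltr.
have cosn : Rintegral nu [set: R] (fun a => cos (w * a) - 1) <= 0.
  rewrite /Rintegral fine_le0//.
  under eq_integral => a _ do rewrite -opprB EFinN.
  rewrite integral_ge0N; last by move=> a _; rewrite lee_fin onesubcos_ge0.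
  rewrite oppe_le0; apply: integral_ge0 => a _.
  by rewrite lee_fin onesubcos_ge0.
have re0 : levy_exp_re s nu w / n%:R <= 0.
  rewrite pmulr_lle0 ?invr_gt0// /levy_exp_re.
  have : 0 <= s ^+ 2 * w ^+ 2 by rewrite mulr_ge0 ?sqr_ge0.
  by lra.
apply: le_trans (onesub_expRcos_le _ re0) _.
rewrite !normrM (ger0_norm (_ : 0 <= n%:R^-1)) ?invr_ge0// -mulrDl ler_pdivrMr//.
have w2 : s ^+ 2 * w ^+ 2 <= n%:R * (s ^+ 2 * r `^ theta).
  have -> : s ^+ 2 * w ^+ 2 = n%:R * (s ^+ 2 * r ^+ 2).
    by rewrite /w exprMn sqr_sqrtr//; ring.
  by rewrite ler_wpM2l// ler_wpM2l ?sqr_ge0// sqr_le_powR.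
have re : `|levy_exp_re s nu w| <=
    n%:R * (s ^+ 2 * r `^ theta) / 2 + n%:R * (2 * r `^ theta) * M.
  apply: le_trans (ler_normD _ _) _; apply: lerD => //.
  rewrite mulNr normrN ger0_norm; first by rewrite ler_pM2r.
  by rewrite divr_ge0// mulr_ge0 ?sqr_ge0.
have im : `|levy_exp_im mu nu w| <=
    n%:R * (`|mu| * r `^ theta) + n%:R * (2 * r `^ theta) * M.
  apply: le_trans (ler_normD _ _) _; apply: lerD => //.
  rewrite normrM mulrCA ler_wpM2l//.
  rewrite ger0_norm ?mulr_ge0// /w mulrC.
  apply: ler_pM => //.
  rewrite -[leRHS](sqr_sqrtr (ler0n R n)) expr2 ler_peMr//.
  by rewrite -[leLHS]sqrtr1 ler_sqrt// ler1n.
by lra.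
Qed.

End LevyBound.

(** * Upper bound for the differential entropy *)

Section EntropyUpper.
Context {R : realType}.
Implicit Types (P : probability R R) (y S : R).

(** Halving [y] lowers the logarithm by at most [ln 4], since [1 + y^2 <= 4 (1 + (y/2)^2)]. While
    [|y| >= 3] the term [4 * ln 4 * fejer_defect y] pays for it; below 3 the logarithm is at most
    [ln 10]. *)
Lemma ln_le_sum_fejer K y : `|y| <= 3 * 2 ^+ K ->
  ln (1 + y ^+ 2) <=
  ln 10 + 4 * ln 4 * \sum_(0 <= k < K) fejer_defect (2^-1 ^+ k * y).
Proof.
have l4 : 0 < ln 4 :> R by rewrite ln_gt0// ltr1n.
have pos (x : R) : 0 < 1 + x ^+ 2 by rewrite ltr_wpDr ?sqr_ge0.
have small (x : R) : `|x| <= 3 -> ln (1 + x ^+ 2) <= ln 10.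
  move=> x3; rewrite ler_ln ?posrE// -real_normK ?num_real//.
  have : `|x| ^+ 2 <= 3 ^+ 2 by rewrite ler_pXn2r ?nnegrE.
  by rewrite (_ : 3 ^+ 2 = 9 :> R); [lra|ring].
elim: K y => [|K IH] y.
  by rewrite expr0 mulr1 big_nil mulr0 addr0 => /small.
move=> yK; have [y3|/ltW y3] := leP `|y| 3.
  rewrite (le_trans (small _ y3))// lerDl mulr_ge0 ?mulr_ge0 ?sumr_ge0 ?ltW//.
  by move=> k _; exact: fejer_defect_ge0.
rewrite big_nat_recl// expr0 mul1r.
have /IH : `|y / 2| <= 3 * 2 ^+ K.
  rewrite normrM (ger0_norm (_ : 0 <= 2^-1))// ler_pdivrMr//.
  by rewrite -mulrA -exprSr.
have -> : \sum_(0 <= k < K) fejer_defect (2^-1 ^+ k * (y / 2)) =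
          \sum_(0 <= k < K) fejer_defect (2^-1 ^+ k.+1 * y).
  by apply: eq_bigr => k _; rewrite exprSr mulrA mulrAC.
have : ln (1 + y ^+ 2) <= ln 4 + ln (1 + (y / 2) ^+ 2).
  rewrite -lnM ?posrE// ler_ln ?posrE ?mulr_gt0//.
  by rewrite exprMn; lra.
have : ln 4 * 4^-1 <= ln 4 * fejer_defect y by rewrite ler_pM2l// fejer_defect_ge.
by lra.
Qed.

(** The number of halvings depends on [y]; the full series of non-negative terms is a bound valid
    for all [y], which can be integrated term by term. *)
Lemma ln_le_fejer_series y :
  ((ln (1 + y ^+ 2))%:E <= (ln 10)%:E +
    \sum_(0 <= k <oo) (4 * ln 4 * fejer_defect (2^-1 ^+ k * y))%:E)%E.
Proof.
have l4 : 0 < ln 4 :> R by rewrite ln_gt0// ltr1n.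
have [K yK] : exists K, `|y| <= 3 * 2 ^+ K.
  exists (Num.bound `|y|).
  apply: (@le_trans _ _ (2 ^+ Num.bound `|y|)).
    rewrite ltW// (lt_trans (archi_boundP (normr_ge0 _)))//.
    by rewrite -natrX ltr_nat ltn_expl.
  by rewrite ler_peMl// ?exprn_ge0// ler1n.
apply: (@le_trans _ _ ((ln 10)%:E +
    \sum_(0 <= k < K) (4 * ln 4 * fejer_defect (2^-1 ^+ k * y))%:E)%E).
  by rewrite sumEFin -EFinD lee_fin -mulr_sumr ln_le_sum_fejer.
rewrite leeD2l//; apply: nneseries_lim_ge => k _ _.
by rewrite lee_fin mulr_ge0 ?fejer_defect_ge0// mulr_ge0// ltW.
Qed.

(** The [k]-th term only involves frequencies up to [2^-k * S], so its mean is at most [C * q^k]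
    with [q = 2^-theta < 1]. The resulting geometric bound does not depend on [S]. *)
Lemma log_mean_le P S (theta C : R) : 0 < S -> 0 < theta -> 0 <= C ->
  (forall r : R, 0 <= r <= 1 ->
     1 - Rintegral P [set: R] (fun x => cos (r * S * x)) <= C * r `^ theta) ->
  (\int[P]_x (ln (1 + (S * x) ^+ 2))%:E <=
    (ln 10 + 4 * ln 4 * (C / (1 - 2^-1 `^ theta)))%:E)%E.
Proof.
move=> S0 t0 C0 hC.
have l4 : 0 < ln 4 :> R by rewrite ln_gt0// ltr1n.
have l10 : 0 < ln 10 :> R by rewrite ln_gt0// ltr1n.
pose q : R := 2^-1 `^ theta.
have q0 : 0 <= q by exact: powR_ge0.
have q1 : q < 1.
  have : (2^-1 : R) `^ theta < 1 `^ theta.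
    by apply: gt0_ltr_powR; rewrite ?nnegrE// invf_lt1// ltr1n.
  by rewrite powR1.
have mk k : measurable_fun [set: R]
    (fun x => (fejer_defect (2^-1 ^+ k * (S * x)))%:E).
  have [+ _ _] := integral_fejer_defect_prob P (2^-1 ^+ k * S) 0.
  by under eq_fun do rewrite subr0 -mulrA.
have f0 k x : (0 <= (fejer_defect (2^-1 ^+ k * (S * x)))%:E)%E.
  by rewrite lee_fin fejer_defect_ge0.
have Ik k : (\int[P]_x (fejer_defect (2^-1 ^+ k * (S * x)))%:E <= (C * q ^+ k)%:E)%E.
  under eq_integral do rewrite mulrA.
  have p0 : 0 < 2^-1 ^+ k :> R by rewrite exprn_gt0.
  apply: fejer_defect_mean_le; first by rewrite mulr_ge0// ltW.
  move=> w /andP[w0 wS].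
  have r0 : 0 <= w / S by rewrite divr_ge0// ltW.
  have rk : w / S <= 2^-1 ^+ k by rewrite ler_pdivrMr.
  have r1 : w / S <= 1.
    by rewrite (le_trans rk)// exprn_ile1// invf_le1// ler1n.
  have := hC (w / S); rewrite r0 r1 divfK ?gt_eqF// => /(_ isT).
  move=> /le_trans; apply; rewrite ler_wpM2l//.
  have -> : q ^+ k = (2^-1 ^+ k) `^ theta.
    by rewrite -!powR_mulrn ?powR_ge0// powRAC.
  by apply: (ge0_ler_powR (ltW t0)) => //; rewrite nnegrE// ltW.
have mS : measurable_fun [set: R] (fun x : R => 1 + (S * x) ^+ 2).
  apply: measurable_funD => //; apply: measurable_funX.
  exact: measurable_funM.
pose D : R := 4 * ln 4; have D0 : 0 <= D by rewrite mulr_ge0// ltW.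
have mDk k : measurable_fun [set: R]
    (fun x => (D * fejer_defect (2^-1 ^+ k * (S * x)))%:E).
  under eq_fun do rewrite EFinM.
  exact: measurable_funeM.
have Df0 k x : (0 <= (D * fejer_defect (2^-1 ^+ k * (S * x)))%:E)%E.
  by rewrite lee_fin mulr_ge0// fejer_defect_ge0.
apply: (@le_trans _ _ (\int[P]_x (cst (ln 10)%:E x +
    \sum_(0 <= k <oo) (D * fejer_defect (2^-1 ^+ k * (S * x)))%:E))%E).
  apply: ge0_le_integral => //.
  - by move=> x _; rewrite lee_fin ln_ge0// lerDl sqr_ge0.
  - by apply/measurable_EFinP; apply: measurableT_comp.
  - apply: emeasurable_funD => //.
    by apply: ge0_emeasurable_sum.
  - by move=> x _; exact: ln_le_fejer_series.
rewrite ge0_integralD//; last 3 first.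
- by move=> x _; rewrite lee_fin ltW.
- by move=> x _; exact: nneseries_ge0.
- by apply: ge0_emeasurable_sum.
rewrite integral_prob_cst integral_nneseries// EFinD leeD2l//.
have cvs : cvgn (fun N => (\sum_(0 <= k < N)
    \int[P]_x (D * fejer_defect (2^-1 ^+ k * (S * x)))%:E)%E).
  by apply: is_cvg_nneseries => k _ _; exact: integral_ge0.
apply: lime_le => //; apply: nearW => N.
apply: (@le_trans _ _ (\sum_(0 <= k < N) (D * (C * q ^+ k))%:E)%E).
  apply: lee_sum => k _.
  under eq_integral do rewrite EFinM.
  by rewrite ge0_integralZl// (EFinM D) lee_wpmul2l.
rewrite sumEFin lee_fin -mulr_sumr ler_wpM2l// -mulr_sumr ler_wpM2l//.
rewrite -/q -div1r ler_pdivlMr ?subr_gt0//.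
have -> : (\sum_(0 <= k < N) q ^+ k) * (1 - q) = 1 - q ^+ N.
  by rewrite big_mkord -opprB -(opprB (q ^+ N)) subrX1 mulrN mulrC.
by rewrite lerBlDr lerDl exprn_ge0.
Qed.

(** The integral is pi, twice the increment of [atan (S * x)] on the half-line; [pi / 2 <= 2] gives
    the bound 4. *)
Lemma integral_cauchy_kernel S : 0 < S ->
  (\int[lebesgue_measure]_x (S / (1 + (S * x) ^+ 2))%:E <= 4%:E)%E.
Proof.
move=> S0; have pos (x : R) : 0 < 1 + (S * x) ^+ 2 by rewrite ltr_wpDr ?sqr_ge0.
have cq : continuous (fun x : R => S / (1 + (S * x) ^+ 2)).
  move=> x; apply: cvgM; first exact: cvg_cst.
  apply: cvgV; first by rewrite gt_eqF.
  apply: cvgD; first exact: cvg_cst.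
  by rewrite expr2; apply: cvgM; apply: cvgM => //; exact: cvg_cst.
rewrite ge0_symfun_integralT//; last 2 first.
- by move=> x; rewrite divr_ge0// ltW.
- by move=> x /=; rewrite mulrN sqrrN.
have dF (x : R) : is_derive x 1 (fun x => atan (S * x)) (S / (1 + (S * x) ^+ 2)).
  apply: is_derive_eq.
  by rewrite /GRing.scale/=; field; rewrite gt_eqF.
have cF : continuous (fun x => atan (S * x)).
  by move=> z; exact/differentiable_continuous/derivable1_diffP/ex_derive.
have lF : atan (S * x) @[x --> +oo] --> pi / 2.
  apply: (@cvg_comp _ _ _ (fun x => S * x) atan); last exact: cvgy_atan.
  exact/gt0_cvgMry/cvg_id.
rewrite -set_itvcy (ge0_continuous_FTC2y _ _ lF).
- rewrite mulr0 atan0 sube0 -EFinM lee_fin.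
  by have [/andP[_ h] _] := @pihalf_02_cos_pihalf R; lra.
- by move=> x _; rewrite divr_ge0// ltW.
- exact: continuous_subspaceT.
- by move=> x _; exact: ex_derive.
- exact/cvg_at_right_filter/cF.
- by move=> x _; rewrite derive1E; exact: derive_val.
Qed.

(* The Borel structure on [R] and the one carrying [lebesgue_measure] have the
   same measurable sets but distinct displays, hence this identity map. *)
Definition borel_id : R -> measurableTypeR R := idfun.

Let measurable_borel_id : measurable_fun [set: R] borel_id.
Proof. by move=> _ A mA; rewrite setTI. Qed.

HB.instance Definition _ :=
  isMeasurableFun.Build _ _ R (measurableTypeR R) borel_id measurable_borel_id.

(** Transport [P] along [borel_id], then identify [g] almost everywhere with the Radon-Nikodym
    derivative, both having the same integral over every measurable set. *)
Lemma ge0_integral_density P (g f : R -> R) :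
  measurable_fun [set: R] g -> (forall x, 0 <= g x) ->
  (forall A, measurable A ->
     P A = (\int[lebesgue_measure]_(x in A) (g x)%:E)%E) ->
  measurable_fun [set: R] f -> (forall x, 0 <= f x) ->
  (\int[lebesgue_measure]_x (f x * g x)%:E = \int[P]_x (f x)%:E)%E.
Proof.
move=> mg g0 Pg mf f0.
pose Q : probability (measurableTypeR R) R := distribution P borel_id.
have -> : (\int[P]_x (f x)%:E = \int[Q]_x (f x)%:E)%E.
  rewrite (ge0_integral_distribution borel_id) => [//||y]; last by rewrite lee_fin.
  exact/measurable_EFinP.
have dom : Q `<< lebesgue_measure.
  apply/null_content_dominatesP => A mA A0; rewrite (Pg A mA).
  by apply: null_set_integral => //; apply/measurable_EFinP/measurable_funTS.
have mgE : measurable_fun [set: measurableTypeR R] (EFin \o g) by exact/measurable_EFinP.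
have mfE : measurable_fun [set: measurableTypeR R] (EFin \o f) by exact/measurable_EFinP.
have mrn := measurable_int _ (Radon_Nikodym_SigmaFinite.f_integrable dom).
rewrite -(Radon_Nikodym_SigmaFinite.change_of_variables dom _ measurableT mfE)//.
have ae : ae_eq lebesgue_measure setT
    (Radon_Nikodym_SigmaFinite.f Q lebesgue_measure) (EFin \o g).
  apply: integral_ae_eq => //.
    exact: Radon_Nikodym_SigmaFinite.f_integrable dom.
  move=> A _ mA; rewrite -(Pg A mA).
  by rewrite -Radon_Nikodym_SigmaFinite.f_integral.
apply: ae_eq_integral => //.
- by apply/measurable_EFinP; exact: measurable_funM.
- exact: emeasurable_funM.
- case: ae => N [mN N0 sN]; exists N; split => // x /= h; apply: sN => /= e.
  by apply: h => _; rewrite (e I) EFinM.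
Qed.

(* Gibbs' inequality against the Cauchy density of scale [1 / S]. *)
Lemma diff_entropy_le_log_mean P z S (L : R) : 0 < S -> is_diff_entropy P z ->
  (\int[P]_x (ln (1 + (S * x) ^+ 2))%:E <= L%:E)%E ->
  z <= L - ln S + 3.
Proof.
(* Final arithmetic, with [a], [b], [c] the integrals of [g ln g], [l g] and [q]; the constant 3 is
   the mass bound 4 minus 1. *)
have concl (a b c : R) : b <= L -> c <= 4 ->
    0 <= a + b + c - (ln S + 1) * 1 -> - a <= L - ln S + 3 by lra.
move=> S0 [g [mg [g0 [Pg [ig ->]]]]] hL.
pose l x : R := ln (1 + (S * x) ^+ 2).
pose q x : R := S / (1 + (S * x) ^+ 2).
have pos (x : R) : 0 < 1 + (S * x) ^+ 2 by rewrite ltr_wpDr ?sqr_ge0.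
have l0 x : 0 <= l x by rewrite ln_ge0// lerDl sqr_ge0.
have q0 x : 0 < q x by rewrite divr_gt0.
have mS : measurable_fun [set: R] (fun x : R => 1 + (S * x) ^+ 2).
  apply: measurable_funD => //; apply: measurable_funX.
  exact: measurable_funM.
have ml : measurable_fun [set: R] l by apply: measurableT_comp.
have mq : measurable_fun [set: R] q.
  apply: continuous_measurable_fun => x; apply: cvgM; first exact: cvg_cst.
  apply: cvgV; first by rewrite gt_eqF.
  apply: cvgD; first exact: cvg_cst.
  by rewrite expr2; apply: cvgM; apply: cvgM => //; exact: cvg_cst.
have ge0_int (f : R -> R) (M : R) : measurable_fun [set: R] f ->
    (forall x, 0 <= f x) -> (\int[lebesgue_measure]_x (f x)%:E <= M%:E)%E ->
    lebesgue_measure.-integrable [set: R] (EFin \o f) /\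
    Rintegral lebesgue_measure [set: R] f <= M.
  move=> mf f0 fM.
  have I0 : (0 <= \int[lebesgue_measure]_x (f x)%:E)%E.
    by apply: integral_ge0 => x _; rewrite lee_fin.
  split.
    apply/integrableP; split; first exact/measurable_EFinP.
    under eq_integral => x _ do rewrite /= ger0_norm//.
    by rewrite (le_lt_trans fM)// ltry.
  rewrite /Rintegral; move: fM I0.
  by case: (\int[lebesgue_measure]_x (f x)%:E)%E => [r| |] //=; rewrite lee_fin.
have [iq hq] := ge0_int q _ mq (fun x => ltW (q0 x)) (integral_cauchy_kernel S0).
have g1 : (\int[lebesgue_measure]_x (g x)%:E = 1%:E)%E.
  by rewrite -Pg//; exact: probability_setT.
have [ig1 _] : lebesgue_measure.-integrable [set: R] (EFin \o g) /\
    Rintegral lebesgue_measure [set: R] g <= 1 by apply: ge0_int; rewrite ?g1.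
have [ilg hlg] : lebesgue_measure.-integrable [set: R] (EFin \o (fun x => l x * g x)) /\
    Rintegral lebesgue_measure [set: R] (fun x => l x * g x) <= L.
  apply: ge0_int.
  - exact: measurable_funM.
  - by move=> x; rewrite mulr_ge0.
  - by rewrite (ge0_integral_density mg g0 Pg ml l0).
(* This is [ln t <= t - 1] at [t = q / g], multiplied by [g], with [ln q = ln S - l]. Where [g]
   vanishes, only [q] remains. *)
have gibbs x : 0 <= g x * ln (g x) + l x * g x + q x - (ln S + 1) * g x.
  have := g0 x; rewrite le_eqVlt => /predU1P[<-|gx].
    by rewrite mul0r !mulr0 add0r add0r subr0 ltW.
  have : ln (q x / g x) <= q x / g x - 1.
    have /le_ln1Dx : -1 < q x / g x - 1 by have := divr_gt0 (q0 x) gx; lra.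
    by rewrite addrC subrK.
  rewrite ln_div ?posrE// /q ln_div ?posrE// -/(q x) -/(l x) => h.
  have : (ln S - l x - ln (g x)) * g x <= (q x / g x - 1) * g x.
    by rewrite ler_wpM2r// ltW.
  by rewrite [leRHS]mulrBl divfK ?gt_eqF//; lra.
have i1 : lebesgue_measure.-integrable [set: R]
    (EFin \o (fun x => g x * ln (g x) + l x * g x)).
  exact: (integrableD measurableT ig ilg).
have i2 : lebesgue_measure.-integrable [set: R]
    (EFin \o (fun x => g x * ln (g x) + l x * g x + q x)).
  exact: (integrableD measurableT i1 iq).
have i3 : lebesgue_measure.-integrable [set: R]
    (EFin \o (fun x => (ln S + 1) * g x)).
  exact: (integrableZl measurableT (ln S + 1) ig1).
have : 0 <= Rintegral lebesgue_measure [set: R]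
    (fun x => g x * ln (g x) + l x * g x + q x - (ln S + 1) * g x).
  by rewrite /Rintegral fine_ge0// integral_ge0// => x _; rewrite lee_fin.
rewrite RintegralB// RintegralD// RintegralD// RintegralZl//.
have -> : Rintegral lebesgue_measure [set: R] g = 1 by rewrite /Rintegral g1.
exact: concl.
Qed.

(** With [S = sqrt n] the term [- ln S] is [- (ln n) / 2]; the other constants are uniform in [n] by
    [levy_charfun_le]. *)
Lemma levy_diff_entropy_le mu s nu nud nuac nucs (P : nat -> probability R R) :
  white_levy_noise mu s nu nud nuac nucs P ->
  exists C : R, forall n z, (0 < n)%N -> is_diff_entropy (P n) z ->
    z <= C - ln n%:R / 2.
Proof.
move=> [_ [lm [_ law]]].
have [theta [C [t0 t1 C0 hC]]] := levy_charfun_le mu s lm.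
exists (ln 10 + 4 * ln 4 * (C / (1 - 2^-1 `^ theta)) + 3) => n z n0 dz.
have nR : 0 < n%:R :> R by rewrite ltr0n.
have S0 : 0 < Num.sqrt n%:R :> R by rewrite sqrtr_gt0.
have := diff_entropy_le_log_mean S0 dz
  (log_mean_le S0 t0 C0 (fun r r01 => hC n (P n) r n0 r01 (law n n0))).
rewrite (ln_nat_sqrt n).
by lra.
Qed.

(** * The limit superior in part (3) *)

Lemma limn_esup_le_near (u : nat -> \bar R) (a : R) :
  (forall e : R, 0 < e -> \forall n \near \oo, (u n <= (a + e)%:E)%E) ->
  (limn_esup u <= a%:E)%E.
Proof.
move=> h; apply/lee_addgt0Pr => e e0; rewrite limn_esup_lim.
apply: lime_le; first exact: is_cvg_esups.
have [N _ hN] := h e e0; exists N => // n /= Nn.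
by apply: ub_ereal_sup => _ [k /= nk <-]; apply: hN; exact: leq_trans nk.
Qed.

Lemma ratio_continuous_gaussian muX sX nuX nudX nuacX nucsX muY sY nuY nudY nuacY nucsY
    (PX PY : nat -> probability R R) (mX mY mf : nat -> nat) (zX zY : nat -> R) :
  white_levy_noise muX sX nuX nudX nuacX nucsX PX ->
  white_levy_noise muY sY nuY nudY nuacY nucsY PY ->
  concl_continuous PX mX zX ->
  0 < sY -> (forall A, nuY A = 0%E) ->
  concl_continuous PY mY zY ->
  (forall n : nat, (maxn (mX n) (mY n) <= mf n)%N) ->
  (fun n : nat => (mf n)%:R / Num.sqrt n%:R : R) @ \oo --> +oo%R ->
  (limn_esup (sup_ratio PX PY mf) <= 1)%E.
Proof.
move=> wX [_ [_ [_ lawY]]] cX sY0 nuY0 cY mXY mfoo.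
apply: limn_esup_le_near => e e0.
have mXf n : (mX n <= mf n)%N by rewrite (leq_trans _ (mXY n))// leq_maxl.
have mYf n : (mY n <= mf n)%N by rewrite (leq_trans _ (mXY n))// leq_maxr.
have [C hC] := levy_diff_entropy_le wX.
have nX := concl_continuous_near cX mXf ltr01.
have nY := concl_continuous_near cY mYf ltr01.
case: cX => dX _.
pose c0 := ln (sY / 16).
(* For [D >= A], the first entry gives [D + C + 1 <= (1 + e) * (D + c0)] and the second
   [D + c0 >= 1]. Since [D = ln (m / sqrt n)], this holds once [m / sqrt n >= exp A]. *)
pose A := Num.max ((C + 1 - c0 - e * c0) / e) (1 - c0).
have nA : \forall n \near \oo, expR A <= (mf n)%:R / Num.sqrt n%:R.
  by move/cvgryPge : mfoo; apply.
near=> n; apply: sup_ratio_le => m nm m0.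
have n0 : (0 < n)%N by near: n; exact: nbhs_infty_gt.
have nR : 0 < n%:R :> R by rewrite ltr0n.
have S0 : 0 < Num.sqrt n%:R :> R by rewrite sqrtr_gt0.
have mR : 0 < m%:R :> R by rewrite ltr0n.
pose D : R := ln m%:R - ln n%:R / 2.
have AD : A <= D.
  rewrite -[A]expRK /D (ln_nat_sqrt n) mulrC mulKf// -ln_div ?posrE//.
  rewrite ler_ln ?posrE ?expR_gt0 ?divr_gt0//.
  apply: (@le_trans _ _ ((mf n)%:R / Num.sqrt n%:R)); first by near: n.
  by rewrite ler_pM2r ?invr_gt0// ler_nat.
have : (C + 1 - c0 - e * c0) / e <= D by rewrite (le_trans _ AD)// le_max lexx.
rewrite ler_pdivrMr// => D1.
have D2 : 1 - c0 <= D by rewrite (le_trans _ AD)// le_max lexx orbT.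
have HX : fine (Hmn PX m n) <= n%:R * (D + C + 1).
  have [_] : Hmn PX m n \is a fin_num /\
      `|fine (Hmn PX m n) / n%:R - (ln m%:R + zX n)| < 1.
    by move: m nm m0 {mR D AD D1 D2}; near: n; exact: nX.
  rewrite ltr_norml => /andP[_ h].
  have := hC n (zX n) n0 (dX n n0) => hz.
  have : fine (Hmn PX m n) / n%:R <= D + C + 1 by rewrite /D; lra.
  by rewrite ler_pdivrMr// mulrC.
have HY : n%:R * (D + c0) <= fine (Hmn PY m n).
  have [fY _] : Hmn PY m n \is a fin_num /\
      `|fine (Hmn PY m n) / n%:R - (ln m%:R + zY n)| < 1.
    by move: m nm m0 {mR D AD D1 D2 HX}; near: n; exact: nY.
  rewrite -lee_fin fineK// EFinM lee_pmul2l//.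
  exact: gaussian_entropy_quant_ge (lawY n n0).
have HY0 : 0 < fine (Hmn PY m n).
  by apply: lt_le_trans HY; rewrite mulr_gt0//; lra.
rewrite ler_pdivrMr// (le_trans HX)//.
apply: (@le_trans _ _ ((1 + e) * (n%:R * (D + c0)))); last first.
  by rewrite ler_pM2l//; lra.
by rewrite mulrCA ler_pM2l//; lra.
Unshelve. all: by end_near. Qed.

End EntropyUpper.

Unset Implicit Arguments.

Theorem mainTheorem6 (R : realType) :
  (* (1) X_0 discrete, Y_0 discrete-continuous *)
  (forall (muX sX muY sY : R)
      (nuX nudX nuacX nucsX nuY nudY nuacY nucsY : {measure set R -> \bar R})
      (PX PY : nat -> probability R R) (mX mY mf : nat -> nat) (zX zY : nat -> R),
    white_levy_noise muX sX nuX nudX nuacX nucsX PX ->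
    white_levy_noise muY sY nuY nudY nuacY nucsY PY ->
    hyp_discrete nuX PX -> concl_discrete PX mX zX ->
    hyp_discrete_continuous PY -> concl_discrete_continuous nuY nudY PY mY zY ->
    (forall n : nat, (maxn (mX n) (mY n) <= mf n)%N) ->
    (fun n : nat => ln (mf n)%:R / ln n%:R : R) @ \oo --> +oo%R ->
    sup_ratio PX PY mf @ \oo --> 0%E) /\
  (* (2) X_0 discrete-continuous, Y_0 continuous *)
  (forall (muX sX muY sY : R)
      (nuX nudX nuacX nucsX nuY nudY nuacY nucsY : {measure set R -> \bar R})
      (PX PY : nat -> probability R R) (mX mY mf : nat -> nat) (zX zY : nat -> R),
    white_levy_noise muX sX nuX nudX nuacX nucsX PX ->
    white_levy_noise muY sY nuY nudY nuacY nucsY PY ->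
    hyp_discrete_continuous PX -> concl_discrete_continuous nuX nudX PX mX zX ->
    hyp_continuous sY nuacY PY -> concl_continuous PY mY zY ->
    (forall n : nat, (maxn (mX n) (mY n) <= mf n)%N) ->
    (fun n : nat => ln (mf n)%:R / `| zY n | : R) @ \oo --> +oo%R ->
    sup_ratio PX PY mf @ \oo --> 0%E) /\
  (* (3) X_0 continuous, Y Gaussian white noise *)
  (forall (muX sX muY sY : R)
      (nuX nudX nuacX nucsX nuY nudY nuacY nucsY : {measure set R -> \bar R})
      (PX PY : nat -> probability R R) (mX mY mf : nat -> nat) (zX zY : nat -> R),
    white_levy_noise muX sX nuX nudX nuacX nucsX PX ->
    white_levy_noise muY sY nuY nudY nuacY nucsY PY ->
    hyp_continuous sX nuacX PX -> concl_continuous PX mX zX ->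
    0 < sY -> (forall A, nuY A = 0%E) ->
    hyp_continuous sY nuacY PY -> concl_continuous PY mY zY ->
    (forall n : nat, (maxn (mX n) (mY n) <= mf n)%N) ->
    (fun n : nat => (mf n)%:R / Num.sqrt n%:R : R) @ \oo --> +oo%R ->
    (limn_esup (sup_ratio PX PY mf) <= 1)%E).
Proof.
split; [|split].
- move=> muX sX muY sY nuX nudX nuacX nucsX nuY nudY nuacY nucsY PX PY mX mY mf
    zX zY _ _ _ cX _ cY.
  exact: ratio_discrete_dc cX cY.
- move=> muX sX muY sY nuX nudX nuacX nucsX nuY nudY nuacY nucsY PX PY mX mY mf
    zX zY _ _ _ cX _ cY.
  exact: ratio_dc_continuous cX cY.
- move=> muX sX muY sY nuX nudX nuacX nucsX nuY nudY nuacY nucsY PX PY mX mY mf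
    zX zY wX wY _ cX s0 nu0 _ cY.
  exact: ratio_continuous_gaussian wX wY cX s0 nu0 cY.
Qed.
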